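(* Let $X(\ell_2)$ be the complex Banach space $\{f\in C[0,1] : f|_\Delta\in E\}$, where $E\subseteq C(\Delta)$ is an isometric copy of the complex Hilbert space $\ell_2$ (see context). Then every non-null hermitian operator $T\in L(X(\ell_2))$ fixes a copy of $\ell_1$, whereas $L(X(\ell_2)^* )$ contains an infinite-dimensional real subspace consisting of finite-rank hermitian operators.
   Context: Construction of $X(E)$: let $\Delta\subset[0,1]$ be the Cantor middle third set. A separable Banach space $E$ is identified, through some fixed linear isometric embedding (which exists by the Banach–Mazur theorem), with a closed subspace of $C(\Delta)$. Then $X(E)=\{f\in C[0,1] : f|_\Delta\in E\}$, with the supremum norm. Here all scalars are complex and $E=\ell_2$. For a complex Banach space $Z$ with dual $Z^*$ and unit sphere $S_Z$, $L(Z)$ is the space of bounded linear operators on $Z$. The numerical range of $T\in L(Z)$ is $V(T)=\{z^*(Tz) : z\in S_Z,\ z^*\in S_{Z^*},\ z^*(z)=1\}$. An operator $T\in L(Z)$ is hermitian if $V(T)\subset\mathbb{R}$. An operator $T\in L(Z)$ fixes a copy of $\ell_1$ if there is a closed subspace of $Z$ isomorphic to $\ell_1$ on which $T$ is an isomorphism onto its image. *)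

(* Defs.v *)
From HB Require Import structures.
From mathcomp Require Import all_boot all_order all_algebra.
From mathcomp Require Import all_classical all_reals all_analysis.
From mathcomp Require Import complex.

Set Implicit Arguments.
Unset Strict Implicit.
Unset Printing Implicit Defensive.

Import Order.TTheory GRing.Theory Num.Theory.
Import numFieldNormedType.Exports.

Local Open Scope classical_set_scope.
Local Open Scope ring_scope.
Local Open Scope complex_scope.

(* In a normed module over R[i] the norm `|x| is a nonnegative element of R[i];
   rnorm is the same number as an element of R, where suprema are available. *)
Section RealNorm.
Variables (R : realType) (V : normedModType R[i]).

Definition rnorm (x : V) : R := complex.Re `|x|.

Lemma rnormE x : `|x| = (rnorm x)%:C.
Proof. by rewrite /rnorm RRe_real // normr_real. Qed.

Lemma rnorm_ge0 x : 0 <= rnorm x.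
Proof. by rewrite -lecR -rnormE normr_ge0. Qed.

Lemma rnorm_le x y : (rnorm x <= rnorm y) = (`|x| <= `|y|).
Proof. by rewrite !rnormE lecR. Qed.

Lemma rnormD x y : rnorm (x + y) <= rnorm x + rnorm y.
Proof. by have := ler_normD x y; rewrite !rnormE -rmorphD lecR. Qed.

Lemma rnorm0 : rnorm 0 = 0.
Proof. by rewrite /rnorm normr0. Qed.

Lemma rnorm_eq0 x : rnorm x = 0 -> x = 0.
Proof. by move=> x0; apply/normr0_eq0; rewrite rnormE x0. Qed.

End RealNorm.

Lemma rnormC (R : realType) (k : R[i]) :
  `|k| = (rnorm (k : R[i]^o))%:C.
Proof. exact: (rnormE (k : R[i]^o)). Qed.

Lemma rnormZ (R : realType) (V : normedModType R[i]) (k : R[i]) (x : V) :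
  rnorm (k *: x) = rnorm (k : R[i]^o) * rnorm x.
Proof.
by apply: complexI; have := normrZ k x; rewrite rnormC !rnormE -rmorphM.
Qed.

Section SupNorm.
Variables (R : realType) (I : Type) (V : normedModType R[i]).
Implicit Types (A : set I) (f g : I -> V).

Definition supnorm A f : R := sup [set rnorm (f x) | x in A].

Definition bounded_on A f := exists M : R, forall x, A x -> rnorm (f x) <= M.

Lemma supnorm_ub A f x : bounded_on A f -> A x -> rnorm (f x) <= supnorm A f.
Proof.
move=> [M fM] Ax; apply: ub_le_sup; last by exists x.
by exists M => _ [y Ay <-]; exact: fM.
Qed.

Lemma supnorm_le A f M : 0 <= M -> (forall x, A x -> rnorm (f x) <= M) ->
  supnorm A f <= M.
Proof.
move=> M0 fM; have [->|A0] := eqVneq A set0.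
  by rewrite /supnorm image_set0 sup0.
apply: ge_sup => [|_ [x Ax <-]]; last exact: fM.
by have /set0P[x Ax] := A0; exists (rnorm (f x)), x.
Qed.

Lemma supnorm_ge0 A f : bounded_on A f -> 0 <= supnorm A f.
Proof.
move=> bf; have [->|A0] := eqVneq A set0.
  by rewrite /supnorm image_set0 sup0.
have /set0P[x Ax] := A0.
exact: (le_trans (rnorm_ge0 (f x)) (supnorm_ub bf Ax)).
Qed.

Lemma supnormD A f g : bounded_on A f -> bounded_on A g ->
  supnorm A (f + g) <= supnorm A f + supnorm A g.
Proof.
move=> bf bg; apply: supnorm_le => [|x Ax].
  by rewrite addr_ge0 ?supnorm_ge0.
by rewrite (le_trans (rnormD _ _))// lerD ?supnorm_ub.
Qed.

Lemma supnormZ_le A (k : R[i]) f : bounded_on A f ->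
  supnorm A (k *: f) <= rnorm (k : R[i]^o) * supnorm A f.
Proof.
move=> bf; apply: supnorm_le => [|x Ax].
  by rewrite mulr_ge0 ?rnorm_ge0 ?supnorm_ge0.
by rewrite [(k *: f) x]/(k *: f x) rnormZ ler_wpM2l ?rnorm_ge0 ?supnorm_ub.
Qed.

Lemma bounded_onZ A (k : R[i]) f : bounded_on A f -> bounded_on A (k *: f).
Proof.
move=> [M fM]; exists (rnorm (k : R[i]^o) * M) => x Ax.
by rewrite [(k *: f) x]/(k *: f x) rnormZ ler_wpM2l ?rnorm_ge0 ?fM.
Qed.

Lemma supnormZ A (k : R[i]) f : bounded_on A f ->
  supnorm A (k *: f) = rnorm (k : R[i]^o) * supnorm A f.
Proof.
move=> bf; apply/eqP; rewrite eq_le supnormZ_le//=.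
have [->|k0] := eqVneq k 0.
  rewrite (_ : rnorm _ = 0) ?mul0r ?supnorm_ge0//; last exact: rnorm0.
  exact: bounded_onZ.
have kk : rnorm (k^-1 : R[i]^o) = (rnorm (k : R[i]^o))^-1.
  by apply: complexI; have := normfV k; rewrite !rnormC -fmorphV.
have k_gt0 : 0 < rnorm (k : R[i]^o).
  by rewrite lt0r rnorm_ge0 andbT; apply: contra_neq k0 => /rnorm_eq0.
rewrite -ler_pdivlMl// -kk -{1}[f](scalerK k0).
by apply: supnormZ_le; exact: bounded_onZ.
Qed.

End SupNorm.

Lemma compact_set_type (X : topologicalType) (A : set X) :
  compact A -> compact [set: A].
Proof.
move=> cA F FF _.
have FA : F (set_val @^-1` A).
  by apply: filterS filterT => -[x xA] _; exact: set_mem xA.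
have [p [Ap clp]] := cA (set_val @ F) _ FA.
exists (exist _ p (mem_set Ap)); split=> // B C FB.
case=> _ [/= [W oW <-] /= Wp WC].
have FB' : F (set_val @^-1` (set_val @` B)).
  by apply: filterS FB => b Bb; exists b.
have [q [[b Bb <-] Wb]] := clp _ _ FB' (open_nbhs_nbhs (conj oW Wp)).
by exists b; split => //; exact: WC.
Qed.

(* C(T), for a compact space T: the continuous functions T -> R[i] with the
   supremum norm. *)
Definition contfun_pred (R : realType) (T : topologicalType) :
  {pred T -> R[i]^o} := fun f => `[< continuous f >].

Record contfun (R : realType) (T : topologicalType)
    (cT : compact [set: T]) := Contfun {
  contfun_fun :> T -> R[i]^o;
  contfunP : contfun_fun \in @contfun_pred R T
}.
Arguments contfun R {T} cT.
Arguments Contfun {R T} cT.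

Section ContfunTheory.
Variables (R : realType) (T : topologicalType) (cT : compact [set: T]).

HB.instance Definition _ := [isSub for @contfun_fun R T cT].
HB.instance Definition _ := [Choice of contfun R cT by <:].

Let contfun_closed : submod_closed (@contfun_pred R T).
Proof.
split=> [|k f g]; first by apply/asboolP => x; exact: cst_continuous.
move=> /asboolP cf /asboolP cg; apply/asboolP => x.
exact: (cvgD (cvgZl_tmp (cf x)) (cg x)).
Qed.

HB.instance Definition _ := GRing.isSubmodClosed.Build R[i] (T -> R[i]^o)
  (@contfun_pred R T) contfun_closed.

Definition contfun_zero : contfun R cT := @Contfun R T cT _ (rpred0 _).
Definition contfun_add (f g : contfun R cT) : contfun R cT :=
  @Contfun R T cT _ (rpredD (contfunP f) (contfunP g)).
Definition contfun_opp (f : contfun R cT) : contfun R cT :=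
  @Contfun R T cT _ (rpredNr (contfunP f)).
Definition contfun_scale (k : R[i]) (f : contfun R cT) : contfun R cT :=
  @Contfun R T cT _ (rpredZ k (contfunP f)).

Let contfun_addA : associative contfun_add.
Proof. by move=> f g h; apply/val_inj; exact: addrA. Qed.

Let contfun_addC : commutative contfun_add.
Proof. by move=> f g; apply/val_inj; exact: addrC. Qed.

Let contfun_add0 : left_id contfun_zero contfun_add.
Proof. by move=> f; apply/val_inj; exact: add0r. Qed.

Let contfun_addN : left_inverse contfun_zero contfun_opp contfun_add.
Proof. by move=> f; apply/val_inj; exact: addNr. Qed.

HB.instance Definition _ := GRing.isZmodule.Build (contfun R cT)
  contfun_addA contfun_addC contfun_add0 contfun_addN.

Let contfun_scaleA (a b : R[i]) (f : contfun R cT) :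
  contfun_scale a (contfun_scale b f) = contfun_scale (a * b) f.
Proof. by apply/val_inj; exact: scalerA. Qed.

Let contfun_scale1 : left_id 1 contfun_scale.
Proof. by move=> f; apply/val_inj; exact: scale1r. Qed.

Let contfun_scaleDr : right_distributive contfun_scale +%R.
Proof. by move=> a f g; apply/val_inj; exact: scalerDr. Qed.

Let contfun_scaleDl (f : contfun R cT) :
  {morph contfun_scale^~ f : a b / a + b}.
Proof. by move=> a b; apply/val_inj; exact: scalerDl. Qed.

HB.instance Definition _ := GRing.Zmodule_isLmodule.Build R[i] (contfun R cT)
  contfun_scaleA contfun_scale1 contfun_scaleDr contfun_scaleDl.

Lemma contfun_continuous (f : contfun R cT) : continuous f.
Proof. by apply/asboolP; exact: contfunP. Qed.

Lemma contfun_bounded (f : contfun R cT) : bounded_on [set: T] f.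
Proof.
have cov : near_covering [set: T] by exact/compact_near_coveringP.
have [x _|M [_ fM]] := cov R +oo (fun M x => rnorm (f x) <= M) _.
  exists ([set y | rnorm (f y) <= rnorm (f x) + 1],
          [set M | rnorm (f x) + 1 <= M]).
    split; last by apply: nbhs_pinfty_ge; exact: num_real.
    have := @contfun_continuous f x => /cvgrPdist_lt/(_ 1 ltr01).
    apply: filterS => y /=; rewrite distrC rnormE ltcR => /ltW fxy.
    rewrite -[f y](subrK (f x)) (le_trans (rnormD _ _))// addrC lerD2l.
    exact: fxy.
  by move=> [y M] /= []; exact: le_trans.
exists (M + 1) => x _; apply: (fM (M + 1)) => //; by rewrite ltrDl ltr01.
Qed.

Let contfun_norm (f : contfun R cT) : R[i] := (supnorm [set: T] f)%:C.

Let contfun_normD (f g : contfun R cT) :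
  contfun_norm (f + g) <= contfun_norm f + contfun_norm g.
Proof. by rewrite -rmorphD lecR supnormD//; exact: contfun_bounded. Qed.

Let contfun_normZ (k : R[i]) (f : contfun R cT) :
  contfun_norm (k *: f) = `|k| * contfun_norm f.
Proof.
by rewrite rnormC -rmorphM /contfun_norm supnormZ//; exact: contfun_bounded.
Qed.

Let contfun_norm_eq0 (f : contfun R cT) : contfun_norm f = 0 -> f = 0.
Proof.
move=> /complexI f0; apply/val_inj/funext => x; apply: rnorm_eq0.
apply/eqP; rewrite eq_le rnorm_ge0 andbT -f0.
by apply: supnorm_ub => //; exact: contfun_bounded.
Qed.

HB.instance Definition _ := Lmodule_isNormed.Build R[i] (contfun R cT)
  contfun_normD contfun_normZ contfun_norm_eq0.

Lemma contfun_normE (f : contfun R cT) :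
  `|f| = (sup [set rnorm (f x) | x in [set: T]])%:C.
Proof. by []. Qed.

End ContfunTheory.

Definition unit_itv (R : realType) : set R := `[0, 1].
Arguments unit_itv R : clear implicits.

Fixpoint cantor_stage (R : realType) (n : nat) : set R :=
  if n is m.+1 then
    [set x / 3 | x in @cantor_stage R m] `|`
    [set (x + 2) / 3 | x in @cantor_stage R m]
  else unit_itv R.
Arguments cantor_stage R n : clear implicits.

Definition cantor_set (R : realType) : set R :=
  \bigcap_(n in [set: nat]) cantor_stage R n.
Arguments cantor_set R : clear implicits.

Lemma cantor_set_unit (R : realType) : cantor_set R `<=` unit_itv R.
Proof. by move=> x /(_ 0%N I). Qed.

Lemma unit_itv_compact (R : realType) : compact [set: unit_itv R].
Proof. by apply: compact_set_type; exact: segment_compact. Qed.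

Lemma cantor_stage_compact (R : realType) n : compact (cantor_stage R n).
Proof.
elim: n => [|n IH] /=; first exact: segment_compact.
apply: compactU; apply: continuous_compact => //; apply: continuous_subspaceT.
  by move=> x; apply: cvgMl; exact: cvg_id.
by move=> x; apply: cvgMl; apply: cvgD; [exact: cvg_id|exact: cvg_cst].
Qed.

Lemma cantor_set_compact (R : realType) : compact [set: cantor_set R].
Proof.
apply: compact_set_type.
apply: (subclosed_compact _ (@segment_compact R 0 1)) (@cantor_set_unit R).
apply: closed_bigI => n _; apply: compact_closed.
  exact: Rhausdorff.
exact: cantor_stage_compact.
Qed.

Definition cantor_incl (R : realType) (t : cantor_set R) : unit_itv R :=
  exist _ (\val t) (mem_set (cantor_set_unit (set_valP t))).

Definition C01 (R : realType) := contfun R (@unit_itv_compact R).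
Definition CDelta (R : realType) := contfun R (@cantor_set_compact R).

(* L(U, V): the bounded linear operators U -> V with the operator norm. *)
Definition bdop_pred (R : realType) (U V : normedModType R[i]) :
  {pred U -> V} := fun f => `[< linear f /\ continuous f >].

Record bdop (R : realType) (U V : normedModType R[i]) := Bdop {
  bdop_fun :> U -> V;
  bdopP : bdop_fun \in @bdop_pred R U V
}.

Section BdopTheory.
Variables (R : realType) (U V : normedModType R[i]).
Implicit Types f g : bdop U V.

HB.instance Definition _ := [isSub for @bdop_fun R U V].
HB.instance Definition _ := [Choice of bdop U V by <:].

Let bdop_closed : submod_closed (@bdop_pred R U V).
Proof.
split=> [|k f g].
  apply/asboolP; split; last by move=> x; exact: cst_continuous.
  by move=> a x y; rewrite /= scaler0 addr0.
move=> /asboolP[lf cf] /asboolP[lg cg]; apply/asboolP; split.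
  move=> a x y; rewrite ![(k *: f + g) _]/(k *: f _ + g _) lf lg.
  by rewrite !scalerDr !scalerA [k * a]mulrC addrACA.
by move=> x; exact: (cvgD (cvgZl_tmp (cf x)) (cg x)).
Qed.

HB.instance Definition _ := GRing.isSubmodClosed.Build R[i] (U -> V)
  (@bdop_pred R U V) bdop_closed.

Definition bdop_zero : bdop U V := Bdop (rpred0 _).
Definition bdop_add (f g : bdop U V) : bdop U V :=
  Bdop (rpredD (bdopP f) (bdopP g)).
Definition bdop_opp (f : bdop U V) : bdop U V := Bdop (rpredNr (bdopP f)).
Definition bdop_scale (k : R[i]) (f : bdop U V) : bdop U V :=
  Bdop (rpredZ k (bdopP f)).

Let bdop_addA : associative bdop_add.
Proof. by move=> f g h; apply/val_inj; exact: addrA. Qed.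

Let bdop_addC : commutative bdop_add.
Proof. by move=> f g; apply/val_inj; exact: addrC. Qed.

Let bdop_add0 : left_id bdop_zero bdop_add.
Proof. by move=> f; apply/val_inj; exact: add0r. Qed.

Let bdop_addN : left_inverse bdop_zero bdop_opp bdop_add.
Proof. by move=> f; apply/val_inj; exact: addNr. Qed.

HB.instance Definition _ := GRing.isZmodule.Build (bdop U V)
  bdop_addA bdop_addC bdop_add0 bdop_addN.

Let bdop_scaleA (a b : R[i]) (f : bdop U V) :
  bdop_scale a (bdop_scale b f) = bdop_scale (a * b) f.
Proof. by apply/val_inj; exact: scalerA. Qed.

Let bdop_scale1 : left_id 1 bdop_scale.
Proof. by move=> f; apply/val_inj; exact: scale1r. Qed.

Let bdop_scaleDr : right_distributive bdop_scale +%R.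
Proof. by move=> a f g; apply/val_inj; exact: scalerDr. Qed.

Let bdop_scaleDl (f : bdop U V) : {morph bdop_scale^~ f : a b / a + b}.
Proof. by move=> a b; apply/val_inj; exact: scalerDl. Qed.

HB.instance Definition _ := GRing.Zmodule_isLmodule.Build R[i] (bdop U V)
  bdop_scaleA bdop_scale1 bdop_scaleDr bdop_scaleDl.

Lemma bdop_linear f : linear f.
Proof. by have /asboolP[] := bdopP f. Qed.

Lemma bdop_continuous f : continuous f.
Proof. by have /asboolP[] := bdopP f. Qed.

HB.instance Definition _ f :=
  GRing.isLinear.Build R[i] U V *:%R (bdop_fun f) (bdop_linear f).

Lemma bdop_bounded f : bounded_on [set x | `|x| <= 1] f.
Proof.
have /linear_bounded_continuous/linear_boundedP := @bdop_continuous f.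
move=> /pinfty_ex_gt0[M M_gt0 fM].
exists (complex.Re M) => x /= x1; rewrite -lecR -rnormE.
rewrite RRe_real ?gtr0_real// (le_trans (fM x))//.
by rewrite ler_piMr// ltW.
Qed.

Let bdop_norm f : R[i] := (supnorm [set x | `|x| <= 1] f)%:C.

Let bdop_normD f g : bdop_norm (f + g) <= bdop_norm f + bdop_norm g.
Proof. by rewrite -rmorphD lecR supnormD//; exact: bdop_bounded. Qed.

Let bdop_normZ (k : R[i]) f : bdop_norm (k *: f) = `|k| * bdop_norm f.
Proof.
by rewrite rnormC -rmorphM /bdop_norm supnormZ//; exact: bdop_bounded.
Qed.

Let bdop_norm_eq0 f : bdop_norm f = 0 -> f = 0.
Proof.
move=> /complexI f0.
have f1 x : `|x| <= 1 -> f x = 0.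
  move=> x1; apply: rnorm_eq0; apply/eqP; rewrite eq_le rnorm_ge0 andbT -f0.
  by apply: supnorm_ub => //; exact: bdop_bounded.
apply/val_inj/funext => x /=; have [->|x0] := eqVneq x 0.
  exact: linear0.
have := f1 (`|x|^-1 *: x); rewrite normfZV// linearZ/= => /(_ (lexx _))/eqP.
by rewrite scaler_eq0 invr_eq0 normr_eq0 (negbTE x0)/= => /eqP.
Qed.

HB.instance Definition _ := Lmodule_isNormed.Build R[i] (bdop U V)
  bdop_normD bdop_normZ bdop_norm_eq0.

Lemma bdop_normE f :
  `|f| = (sup [set rnorm (f x) | x in [set x | `|x| <= 1]])%:C.
Proof. by []. Qed.

End BdopTheory.

Notation dual_space Z := (bdop Z (_[i]^o)).

(* Complex l^p, 1 <= p < oo, as L^p of the counting measure on nat. *)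
Definition lp_norm (R : realType) (p : R) (a : nat -> R[i]^o) : \bar R :=
  Lnorm counting p%:E (fun n => (rnorm (a n))%:E).

Definition lp_pred (R : realType) (p : R) : {pred nat -> R[i]^o} :=
  fun a => (lp_norm p a < +oo)%E.

Record lp (R : realType) (p : R) (p1 : 1 <= p) := Lp {
  lp_fun :> nat -> R[i]^o;
  lpP : lp_fun \in lp_pred p
}.
Arguments lp {R p} p1.

Section LpTheory.
Variables (R : realType) (p : R) (p1 : 1 <= p).
Implicit Types a b : nat -> R[i]^o.

Let p_gt0 : 0 < p. Proof. exact: lt_le_trans p1. Qed.

HB.instance Definition _ := [isSub for @lp_fun R p p1].
HB.instance Definition _ := [Choice of lp p1 by <:].

Lemma lp_normE a : lp_norm p a =
  ((\sum_(0 <= k <oo) (rnorm (a k) `^ p)%:E) `^ p^-1)%E.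
Proof.
rewrite /lp_norm Lnorm_counting//; congr (_ `^ _)%E; apply: eq_eseriesr => k _.
by rewrite gee0_abs ?lee_fin ?rnorm_ge0// poweR_EFin.
Qed.

Lemma lp_norm_ge0 a : (0 <= lp_norm p a)%E.
Proof. exact: Lnorm_ge0. Qed.

Lemma lp_normD a b : (lp_norm p (a + b)%R <= lp_norm p a + lp_norm p b)%E.
Proof.
apply: (@le_trans _ _ (Lnorm counting p%:E (EFin \o
    ((fun n => rnorm (a n)) \+ (fun n => rnorm (b n)))%R))).
  rewrite /lp_norm !Lnorm_counting//; apply: gt0_ler_poweR.
  - by rewrite invr_ge0 ltW.
  - by rewrite in_itv/= leey andbT nneseries_ge0// => k _ _; rewrite poweR_ge0.
  - by rewrite in_itv/= leey andbT nneseries_ge0// => k _ _; rewrite poweR_ge0.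
  apply: lee_nneseries => k _; first by rewrite poweR_ge0.
  rewrite !gee0_abs /= ?lee_fin ?addr_ge0 ?rnorm_ge0//.
  rewrite ge0_ler_powR ?nnegrE ?addr_ge0 ?rnorm_ge0 ?(ltW p_gt0)//.
  exact: rnormD.
exact: eminkowski.
Qed.

Lemma lp_normZ (k : R[i]) a :
  (lp_norm p (k *: a)%R = (rnorm (k : R[i]^o))%:E * lp_norm p a)%E.
Proof.
rewrite !lp_normE.
under eq_eseriesr => n _.
  rewrite [(k *: a) n]/(k *: a n) rnormZ powRM ?rnorm_ge0// EFinM.
  over.
rewrite nneseriesZl => [|n _]; last by rewrite lee_fin powR_ge0.
rewrite poweRM ?lee_fin ?powR_ge0//; last first.
  by apply: nneseries_ge0 => n _ _; rewrite lee_fin powR_ge0.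
by rewrite poweR_EFin -powRrM mulfV ?gt_eqF// powRr1 ?rnorm_ge0.
Qed.

Lemma lp_norm_ub a n : ((rnorm (a n))%:E <= lp_norm p a)%E.
Proof.
rewrite lp_normE -[leLHS]poweRe1 ?lee_fin ?rnorm_ge0//.
rewrite -(mulfV (lt0r_neq0 p_gt0)) poweRrM poweR_EFin.
have s0 k : true -> (0 <= (rnorm (a k) `^ p)%:E)%E.
  by rewrite lee_fin powR_ge0.
apply: gt0_ler_poweR.
- by rewrite invr_ge0 ltW.
- by rewrite in_itv/= leey andbT lee_fin powR_ge0.
- by rewrite in_itv/= leey andbT nneseries_ge0// => k _ _; exact: s0.
apply: le_trans (nneseries_lim_ge n.+1 _) => [|k _]; last exact: s0.
by rewrite big_nat_recr//= leeDr// sume_ge0.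
Qed.

Let lp_closed : submod_closed (@lp_pred R p).
Proof.
split=> [|k a b]; rewrite !unfold_in /lp_pred.
  rewrite -[0](scale0r 0) lp_normZ.
  by rewrite [rnorm _]rnorm0 mul0e.
move=> afin bfin; apply: le_lt_trans (lp_normD _ _) _.
rewrite lte_add_pinfty// lp_normZ lte_mul_pinfty// lee_fin rnorm_ge0//.
Qed.

HB.instance Definition _ := GRing.isSubmodClosed.Build R[i] (nat -> R[i]^o)
  (@lp_pred R p) lp_closed.

Definition lp_zero : lp p1 := @Lp R p p1 _ (rpred0 _).
Definition lp_add (f g : lp p1) : lp p1 :=
  @Lp R p p1 _ (rpredD (lpP f) (lpP g)).
Definition lp_opp (f : lp p1) : lp p1 := @Lp R p p1 _ (rpredNr (lpP f)).
Definition lp_scale (k : R[i]) (f : lp p1) : lp p1 :=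
  @Lp R p p1 _ (rpredZ k (lpP f)).

Let lp_addA : associative lp_add.
Proof. by move=> f g h; apply/val_inj; exact: addrA. Qed.

Let lp_addC : commutative lp_add.
Proof. by move=> f g; apply/val_inj; exact: addrC. Qed.

Let lp_add0 : left_id lp_zero lp_add.
Proof. by move=> f; apply/val_inj; exact: add0r. Qed.

Let lp_addN : left_inverse lp_zero lp_opp lp_add.
Proof. by move=> f; apply/val_inj; exact: addNr. Qed.

HB.instance Definition _ := GRing.isZmodule.Build (lp p1)
  lp_addA lp_addC lp_add0 lp_addN.

Let lp_scaleA (a b : R[i]) (f : lp p1) :
  lp_scale a (lp_scale b f) = lp_scale (a * b) f.
Proof. by apply/val_inj; exact: scalerA. Qed.

Let lp_scale1 : left_id 1 lp_scale.
Proof. by move=> f; apply/val_inj; exact: scale1r. Qed.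

Let lp_scaleDr : right_distributive lp_scale +%R.
Proof. by move=> a f g; apply/val_inj; exact: scalerDr. Qed.

Let lp_scaleDl (f : lp p1) : {morph lp_scale^~ f : a b / a + b}.
Proof. by move=> a b; apply/val_inj; exact: scalerDl. Qed.

HB.instance Definition _ := GRing.Zmodule_isLmodule.Build R[i] (lp p1)
  lp_scaleA lp_scale1 lp_scaleDr lp_scaleDl.

Lemma lp_norm_fin (a : lp p1) : lp_norm p a \is a fin_num.
Proof. by rewrite ge0_fin_numE ?lp_norm_ge0//; exact: (lpP a). Qed.

Let lp_nm (a : lp p1) : R[i] := (fine (lp_norm p a))%:C.

Let lp_nmD (a b : lp p1) : lp_nm (a + b) <= lp_nm a + lp_nm b.
Proof.
rewrite -rmorphD lecR -lee_fin EFinD !fineK ?lp_norm_fin//; exact: lp_normD.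
Qed.

Let lp_nmZ (k : R[i]) (a : lp p1) : lp_nm (k *: a) = `|k| * lp_nm a.
Proof.
rewrite rnormC -rmorphM; congr (_ %:C); apply: EFin_inj.
by rewrite EFinM !fineK ?lp_norm_fin//; exact: lp_normZ.
Qed.

Let lp_nm_eq0 (a : lp p1) : lp_nm a = 0 -> a = 0.
Proof.
move=> /complexI a0; apply/val_inj/funext => n; apply: rnorm_eq0.
apply/eqP; rewrite eq_le rnorm_ge0 andbT -lee_fin -a0 fineK ?lp_norm_fin//.
exact: lp_norm_ub.
Qed.

HB.instance Definition _ := Lmodule_isNormed.Build R[i] (lp p1)
  lp_nmD lp_nmZ lp_nm_eq0.

Lemma lp_normrE (a : lp p1) : `|a| = (fine (lp_norm p a))%:C.
Proof. by []. Qed.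

End LpTheory.

Definition l1 (R : realType) := lp (lexx (1 : R)).
Definition l2 (R : realType) := lp (ler1n R 2).

(* X(E), for E embedded in C(Delta) by J: the f in C[0, 1] whose restriction
   to the Cantor set Delta lies in the range of J. *)
Definition XE_pred (R : realType) (E : normedModType R[i])
    (J : {linear E -> CDelta R}) : {pred C01 R} :=
  fun f => `[< exists e : E, f \o @cantor_incl R = J e >].

Record XE (R : realType) (E : normedModType R[i])
    (J : {linear E -> CDelta R}) := MkXE {
  XE_fun :> contfun R (@unit_itv_compact R);
  XEP : XE_fun \in XE_pred J
}.

Section XETheory.
Variables (R : realType) (E : normedModType R[i]) (J : {linear E -> CDelta R}).

HB.instance Definition _ := [isSub for @XE_fun R E J].
HB.instance Definition _ := [Choice of XE J by <:].

Let XE_closed : submod_closed (XE_pred J).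
Proof.
split=> [|k f g].
  by apply/asboolP; exists 0; rewrite linear0.
move=> /asboolP[e fe] /asboolP[d gd]; apply/asboolP; exists (k *: e + d).
rewrite linearP; apply/funext => t.
have := congr1 (@^~ t) fe; have := congr1 (@^~ t) gd => /= {}gd {}fe.
by rewrite [LHS]/(k *: f _ + g _) fe gd.
Qed.

HB.instance Definition _ := GRing.isSubmodClosed.Build R[i] (C01 R)
  (XE_pred J) XE_closed.

Definition XE_zero : XE J := MkXE (rpred0 _).
Definition XE_add (f g : XE J) : XE J := MkXE (rpredD (XEP f) (XEP g)).
Definition XE_opp (f : XE J) : XE J := MkXE (rpredNr (XEP f)).
Definition XE_scale (k : R[i]) (f : XE J) : XE J := MkXE (rpredZ k (XEP f)).

Let XE_addA : associative XE_add.
Proof. by move=> f g h; apply/val_inj; exact: addrA. Qed.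

Let XE_addC : commutative XE_add.
Proof. by move=> f g; apply/val_inj; exact: addrC. Qed.

Let XE_add0 : left_id XE_zero XE_add.
Proof. by move=> f; apply/val_inj; exact: add0r. Qed.

Let XE_addN : left_inverse XE_zero XE_opp XE_add.
Proof. by move=> f; apply/val_inj; exact: addNr. Qed.

HB.instance Definition _ := GRing.isZmodule.Build (XE J)
  XE_addA XE_addC XE_add0 XE_addN.

Let XE_scaleA (a b : R[i]) (f : XE J) :
  XE_scale a (XE_scale b f) = XE_scale (a * b) f.
Proof. by apply/val_inj; exact: scalerA. Qed.

Let XE_scale1 : left_id 1 XE_scale.
Proof. by move=> f; apply/val_inj; exact: scale1r. Qed.

Let XE_scaleDr : right_distributive XE_scale +%R.
Proof. by move=> a f g; apply/val_inj; exact: scalerDr. Qed.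

Let XE_scaleDl (f : XE J) : {morph XE_scale^~ f : a b / a + b}.
Proof. by move=> a b; apply/val_inj; exact: scalerDl. Qed.

HB.instance Definition _ := GRing.Zmodule_isLmodule.Build R[i] (XE J)
  XE_scaleA XE_scale1 XE_scaleDr XE_scaleDl.

Let XE_norm (f : XE J) : R[i] := `|XE_fun f|.

Let XE_normD (f g : XE J) : XE_norm (f + g) <= XE_norm f + XE_norm g.
Proof. exact: ler_normD. Qed.

Let XE_normZ (k : R[i]) (f : XE J) : XE_norm (k *: f) = `|k| * XE_norm f.
Proof. exact: normrZ. Qed.

Let XE_norm_eq0 (f : XE J) : XE_norm f = 0 -> f = 0.
Proof. by move=> /normr0_eq0 f0; apply/val_inj. Qed.

HB.instance Definition _ := Lmodule_isNormed.Build R[i] (XE J)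
  XE_normD XE_normZ XE_norm_eq0.

Lemma XE_normE (f : XE J) : `|f| = `|XE_fun f|.
Proof. by []. Qed.

End XETheory.

Section Operators.
Variables (R : realType) (Z : normedModType R[i]).
Implicit Types T : bdop Z Z.

Definition numerical_range T : set R[i] :=
  [set w | exists (z : Z) (zs : dual_space Z),
     [/\ `|z| = 1, `|zs| = 1, zs z = 1 & w = zs (T z)]].

Definition hermitian_op T :=
  numerical_range T `<=` [set w | w \is Num.real].

End Operators.

Section Subspaces.
Variables (R : realType) (V : lmodType R[i]).

(* k is the set of admissible scalars: [set: R[i]] for complex subspaces, the
   reals inside R[i] for real subspaces. *)
Definition subspace_over (k : set R[i]) (S : set V) :=
  [/\ S 0, forall x y, S x -> S y -> S (x + y) &
      forall c x, k c -> S x -> S (c *: x)].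

Definition finite_dim_over (k : set R[i]) (S : set V) :=
  exists (n : nat) (v : 'I_n -> V), (forall i, S (v i)) /\
    forall x, S x -> exists c : 'I_n -> R[i],
      (forall i, k (c i)) /\ x = \sum_i c i *: v i.

End Subspaces.

Definition complex_scalars (R : realType) : set R[i] := setT.
Definition real_scalars (R : realType) : set R[i] := [set c | c \is Num.real].
Arguments complex_scalars R : clear implicits.
Arguments real_scalars R : clear implicits.

Definition finite_rank (R : realType) (U V : normedModType R[i])
  (T : bdop U V) := finite_dim_over (complex_scalars R) (range T).

(* T restricts to a linear homeomorphism of A onto B. *)
Definition isomorphism_between (R : realType) (U V : normedModType R[i])
    (A : set U) (B : set V) (T : bdop U V) :=
  set_bij A B T /\
  exists S : V -> U, {in A, cancel T S} /\ {within B, continuous S}.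

Definition fixes_copy_of_l1 (R : realType) (Z : normedModType R[i])
    (T : bdop Z Z) :=
  exists Y : set Z,
    [/\ subspace_over (complex_scalars R) Y,
        closed Y,
        exists F : bdop (l1 R) Z, isomorphism_between [set: l1 R] Y F &
        isomorphism_between Y [set T y | y in Y] T].

(* Main.v *)
(** Hermitian operators on X(E) are local off the Cantor set D: if s is not in D
    and f(s) = 0, |f| <= 1, then for a tent g at s vanishing on D and every
    unimodular w the function g (1 - |f|) + w f has norm 1 and value 1 at s, so
    T(g (1 - |f|))(s) + w (T f)(s) is real for all w and (T f)(s) = 0. Hence
    f(s) (T g)(s) = g(s) (T f)(s) for all f and g off D. As D has empty interior,
    T f is nonzero at some point off D, hence bounded away from 0 on an interval
    there, and T is bounded below on functions living on that interval. These
    contain a copy of l1, spanned by lacunary cosines times a tent.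

    For the dual, the functions vanishing on D form an M-ideal of X(E) with
    quotient E. A lift of e in E multiplied by cutoffs concentrating on D has a
    limit in X(E)^** along an ultrafilter; this embeds E in X(E)^**. Composing the
    images of the unit vectors e_n of l2 with the coordinate functionals of the
    trace on D gives rank-one projections P_n of X(E)^* such that
    |al phi + be P_n phi| <= |al| |phi| whenever |al + be| = |al|, which forces
    P_n to be hermitian. Their real span is the required space. *)

Require Import Defs.
From mathcomp Require Import all_boot all_order all_algebra.
From mathcomp Require Import all_classical all_reals all_analysis.
From mathcomp Require Import complex.
From mathcomp Require Import ring lra.
Import Order.TTheory GRing.Theory Num.Theory.
Import numFieldNormedType.Exports.
Local Open Scope classical_set_scope.
Local Open Scope ring_scope.

Set Implicit Arguments.
Unset Strict Implicit.
Unset Printing Implicit Defensive.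

(** * Real-valued norms, complex limits and bounded operators *)

Lemma rnorm_normr (R : realType) (V : normedModType R[i]) (x : V) (M : R) :
  (rnorm x <= M) = (`|x| <= M%:C%C).
Proof. by rewrite rnormE lecR. Qed.

Lemma rnormN (R : realType) (V : normedModType R[i]) (x : V) :
  rnorm (- x) = rnorm x.
Proof. by rewrite /rnorm normrN. Qed.

Lemma rdistC (R : realType) (V : normedModType R[i]) (x y : V) :
  rnorm (x - y) = rnorm (y - x).
Proof. by rewrite -opprB rnormN. Qed.

Lemma rnorm_sum (R : realType) (V : normedModType R[i]) (I : Type)
    (r : seq I) (P : pred I) (F : I -> V) :
  rnorm (\sum_(i <- r | P i) F i) <= \sum_(i <- r | P i) rnorm (F i).
Proof.
elim/big_ind2 : _ => //; first by rewrite rnorm0.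
by move=> x x' y y' h h'; rewrite (le_trans (rnormD _ _))// lerD.
Qed.

Section Scalars.
Variable R : realType.
Implicit Types x y z : R[i]^o.

Lemma rnormM x y : rnorm (x * y : R[i]^o) = rnorm x * rnorm y.
Proof. exact: rnormZ. Qed.

Lemma rnorm_sqr z : rnorm z ^+ 2 = complex.Re z ^+ 2 + complex.Im z ^+ 2.
Proof.
case: z => a b; rewrite /rnorm normc_def /= sqr_sqrtr//.
by rewrite addr_ge0 ?sqr_ge0.
Qed.

Lemma rnorm_le_sqr z (M : R) : 0 <= M ->
  (rnorm z <= M) = (complex.Re z ^+ 2 + complex.Im z ^+ 2 <= M ^+ 2).
Proof. by move=> M0; rewrite -rnorm_sqr ler_sqr ?nnegrE ?rnorm_ge0. Qed.

Lemma rnormR (r : R) : rnorm (r%:C%C : R[i]^o) = `|r|.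
Proof. by rewrite /rnorm normc_def /= expr0n addr0 sqrtr_sqr. Qed.

Lemma Re_le_rnorm z : `|complex.Re z| <= rnorm z.
Proof.
rewrite -ler_sqr ?nnegrE ?rnorm_ge0// rnorm_sqr real_normK ?num_real//.
by rewrite lerDl sqr_ge0.
Qed.

Lemma Im_le_rnorm z : `|complex.Im z| <= rnorm z.
Proof.
rewrite -ler_sqr ?nnegrE ?rnorm_ge0// rnorm_sqr real_normK ?num_real//.
by rewrite lerDr sqr_ge0.
Qed.

Lemma rnorm_le_ReIm z : rnorm z <= `|complex.Re z| + `|complex.Im z|.
Proof.
rewrite rnorm_le_sqr ?addr_ge0// sqrrD !real_normK ?num_real//.
by rewrite -addrA lerD2l lerDr mulrn_wge0// mulr_ge0.
Qed.

End Scalars.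

Lemma cvg_rnormP (R : realType) (V : normedModType R[i]) (T : Type)
    (F : set_system T) {FF : Filter F} (f : T -> V) (l : V) :
  f @ F --> l <-> forall e : R, 0 < e -> \forall x \near F, rnorm (l - f x) < e.
Proof.
split=> [/cvgrPdist_lt fl e e0|fl].
  have /fl : 0 < e%:C%C by rewrite ltcR.
  by apply: filterS => x; rewrite rnormE ltcR.
apply/cvgrPdist_lt => e e0.
have eE : e = (complex.Re e)%:C%C by rewrite RRe_real// gtr0_real.
have := fl (complex.Re e); rewrite -ltcR -eE => /(_ e0).
by apply: filterS => x; rewrite rnormE [in X in _ -> X]eE ltcR.
Qed.

Lemma cvg_ReIm (R : realType) (T : Type)
    (F : set_system T) {FF : Filter F} (f g : T -> R) (a b : R) :
  f @ F --> a -> g @ F --> b ->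
  (fun x => Complex (f x) (g x) : R[i]^o) @ F --> (Complex a b : R[i]^o).
Proof.
move=> /cvgrPdist_lt fa /cvgrPdist_lt gb; apply/cvg_rnormP => e e0.
have e2 : 0 < e / 2 by rewrite divr_gt0.
near=> x; rewrite (le_lt_trans (rnorm_le_ReIm _))//= [ltRHS]splitr.
by rewrite ltrD//; near: x; [exact: fa|exact: gb].
Unshelve. all: by end_near. Qed.

Lemma cvg_Re (R : realType) (T : Type)
    (F : set_system T) {FF : Filter F} (f : T -> R[i]^o) (a : R[i]^o) :
  f @ F --> a -> (fun x => complex.Re (f x)) @ F --> complex.Re a.
Proof.
move=> /cvg_rnormP fa; apply/cvgrPdist_lt => e /fa.
by apply: filterS => x; apply: le_lt_trans; rewrite -raddfB; exact: Re_le_rnorm.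
Qed.

Lemma cvg_Im (R : realType) (T : Type)
    (F : set_system T) {FF : Filter F} (f : T -> R[i]^o) (a : R[i]^o) :
  f @ F --> a -> (fun x => complex.Im (f x)) @ F --> complex.Im a.
Proof.
move=> /cvg_rnormP fa; apply/cvgrPdist_lt => e /fa.
by apply: filterS => x; apply: le_lt_trans; rewrite -raddfB; exact: Im_le_rnorm.
Qed.

Lemma cvg_rnorm (R : realType) (T : Type) (V : normedModType R[i])
    (F : set_system T) {FF : Filter F} (f : T -> V) (a : V) :
  f @ F --> a -> (fun x => rnorm (f x)) @ F --> rnorm a.
Proof.
move=> /cvg_rnormP fa; apply/cvgrPdist_lt => e /fa.
apply: filterS => x; apply: le_lt_trans; rewrite ler_norml lerBrDr lerBlDr.
apply/andP; split.
  rewrite addrC lerBlDr rdistC -{1}[f x](subrK a).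
  by rewrite (le_trans (rnormD _ _))// addrC.
by rewrite -{1}[a](subrK (f x)) (le_trans (rnormD _ _)).
Qed.

Section Bdop.
Variables (R : realType) (U V : normedModType R[i]).

Lemma bdop_le (f : bdop U V) (x : U) : rnorm (f x) <= rnorm f * rnorm x.
Proof.
have fE : rnorm f = supnorm [set x | `|x| <= 1] f by rewrite /rnorm bdop_normE.
have [->|x0] := eqVneq x 0.
  by rewrite linear0 !rnorm0 mulr0.
have xx : (rnorm x)%:C%C != 0 by rewrite -rnormE normr_eq0.
rewrite -[x in f x](scalerKV xx) linearZ rnormZ mulrC fE.
have xg : 0 < rnorm x.
  by rewrite lt0r rnorm_ge0 andbT; apply: contra_neq x0 => /rnorm_eq0.
rewrite rnormR gtr0_norm ?ler_wpM2r ?rnorm_ge0//; last first.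
apply: supnorm_ub; first exact: bdop_bounded.
by rewrite /= -rnormE normfZV.
Qed.

Lemma bdop_norm_le (f : bdop U V) (M : R) : 0 <= M ->
  (forall x, rnorm (f x) <= M * rnorm x) -> rnorm f <= M.
Proof.
move=> M0 fM; rewrite {1}/rnorm bdop_normE /=; apply: supnorm_le => // x /= x1.
apply: le_trans (fM x) _; rewrite ler_piMr//.
by rewrite rnorm_normr.
Qed.

Lemma bounded_linear_bdop (f : U -> V) : linear f ->
  (exists M : R, forall x, rnorm (f x) <= M * rnorm x) -> f \in @bdop_pred R U V.
Proof.
move=> lf [M fM]; apply/asboolP; split => // x.
(* The given [M] may be zero or negative; this replacement can be divided by. *)
have M0 : 0 < `|M| + 1 by rewrite ltr_wpDl.
have fM' y : rnorm (f y) <= (`|M| + 1) * rnorm y.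
  apply: le_trans (fM y) _; rewrite ler_wpM2r ?rnorm_ge0//.
  by rewrite (le_trans (ler_norm M))// lerDl.
apply/cvg_rnormP => e e0.
have /cvg_rnormP/(_ (e / (`|M| + 1))) := @cvg_id _ (nbhs x) .
rewrite divr_gt0// => /(_ isT); apply: filterS => y xy.
have -> : f x - f y = f (x - y) by rewrite -scaleN1r addrC -lf scaleN1r addrC.
by rewrite (le_lt_trans (fM' _))// mulrC -ltr_pdivlMr.
Qed.

End Bdop.

Section Contfun.
Variables (R : realType) (T : topologicalType) (cT : compact [set: T]).
Implicit Types f g : contfun R cT.

Lemma contfun_le f t : rnorm (f t) <= rnorm f.
Proof.
rewrite {2}/rnorm contfun_normE /=.
by apply: supnorm_ub => //; exact: contfun_bounded.
Qed.

Lemma contfun_norm_le f (M : R) : 0 <= M ->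
  (forall t, rnorm (f t) <= M) -> rnorm f <= M.
Proof.
by move=> M0 fM; rewrite /rnorm contfun_normE /=; apply: supnorm_le.
Qed.

End Contfun.

Lemma Im0_real (R : realType) (w : R[i]) : complex.Im w = 0 -> w \is Num.real.
Proof.
case: w => a b /= ->; have /orP[a0|a0] := num_real a.
  by apply/ger0_real; rewrite -[Complex _ _]/(a%:C)%C ler0c.
by apply/ler0_real; rewrite -[Complex _ _]/(a%:C)%C lecR.
Qed.

Lemma real_Im0 (R : realType) (w : R[i]) : w \is Num.real -> complex.Im w = 0.
Proof. by rewrite realE !lecE /= => /orP[] /andP[/eqP]. Qed.

Lemma bdop_sumE (R : realType) (U V : normedModType R[i]) (I : Type)
    (r : seq I) (P : pred I) (F : I -> bdop U V) x :
  (\sum_(i <- r | P i) F i) x = \sum_(i <- r | P i) F i x.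
Proof. exact: (big_morph (fun T : bdop U V => T x)). Qed.

Section BdopLinear.
Variables (R : realType) (U V : normedModType R[i]).
Implicit Types (f : bdop U V) (x y : U).

Lemma bdopD f x y : f (x + y) = f x + f y. Proof. exact: linearD. Qed.
Lemma bdopB f x y : f (x - y) = f x - f y. Proof. exact: linearB. Qed.
Lemma bdopZ f k x : f (k *: x) = k *: f x. Proof. exact: linearZ. Qed.

End BdopLinear.

(** Compactness of [[- M, M]] yields a cluster point, and an ultrafilter converges to its cluster
    points: otherwise it would contain the complement of a ball around one. *)
Lemma ultra_cvg_bounded (R : realType) (T : Type) (F : set_system T)
    {UF : UltraFilter F} (f : T -> R) (M : R) :
  F [set x | `|f x| <= M] -> cvg (f x @[x --> F]).
Proof.
move=> fM; have fM' : (f @ F) [set` `[- M, M]].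
  apply: (@filterS _ F _ _ _ _ fM) => x /=.
  by rewrite in_itv/= ler_norml.
have [p [_ clp]] := @segment_compact R _ _ _ _ fM'.
apply/cvg_ex; exists p; apply/cvgrPdist_lt => e e0.
have [//|nF] := in_ultra_setVsetC [set x | `|p - f x| < e] UF.
have [] := clp (~` ball p e) (ball p e) nF (nbhsx_ballx p e e0).
by move=> q [].
Qed.

Lemma ultra_cvg_complex (R : realType) (T : Type) (F : set_system T)
    {UF : UltraFilter F} (f : T -> R[i]^o) (M : R) :
  F [set x | rnorm (f x) <= M] -> cvg (f x @[x --> F]).
Proof.
move=> fM.
have /cvg_ex[a fa] : cvg (complex.Re (f x) @[x --> F]).
  apply: (@ultra_cvg_bounded _ _ _ _ _ M); apply: filterS fM => x /=.
  exact: le_trans (Re_le_rnorm _).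
have /cvg_ex[b fb] : cvg (complex.Im (f x) @[x --> F]).
  apply: (@ultra_cvg_bounded _ _ _ _ _ M); apply: filterS fM => x /=.
  exact: le_trans (Im_le_rnorm _).
apply/cvg_ex; exists (Complex a b : R[i]^o).
rewrite (_ : f = fun x => Complex (complex.Re (f x)) (complex.Im (f x))).
  exact: cvg_ReIm fa fb.
by apply/funext => x; case: (f x).
Qed.

(** * The Cantor set *)

Section CantorSet.
Variable R : realType.

Lemma cantor_set_closed : closed (cantor_set R).
Proof.
apply: closed_bigI => n _; apply: compact_closed; first exact: Rhausdorff.
exact: cantor_stage_compact.
Qed.

Lemma cantor_set1 : cantor_set R 1.
Proof.
move=> n _; elim: n => [|n IHn] /=; first by rewrite /unit_itv/= in_itv/= ler01 lexx.
by right; exists 1; [exact: IHn|lra].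
Qed.

Lemma cantor_stage_unit n x : cantor_stage R n x -> 0 <= x <= 1.
Proof.
elim: n x => [x|n IHn x] /=; first by rewrite /unit_itv/= in_itv.
by case=> -[y /IHn /andP[y0 y1] <-]; apply/andP; split; lra.
Qed.

Lemma cantor_set_thirds (x : R) : cantor_set R x ->
  exists2 y, 0 <= y <= 1 & x = y / 3 \/ x = (y + 2) / 3.
Proof.
by move=> /(_ 1%N I) [] [y /(@cantor_stage_unit 0) y01 <-]; exists y => //;
  [left|right].
Qed.

Lemma cantor_set_third (x : R) : x <= 1 -> cantor_set R (x / 3) -> cantor_set R x.
Proof.
move=> x1 Dx n _; have [[y yn yx]|[y yn yx]] := Dx n.+1 I.
  by have <- : y = x by lra.
have /andP[y0 _] := cantor_stage_unit yn.
exfalso; lra.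
Qed.

Lemma cantor_set_two_thirds (x : R) : 0 <= x -> cantor_set R ((x + 2) / 3) ->
  cantor_set R x.
Proof.
move=> x0 Dx n _; have [[y yn yx]|[y yn yx]] := Dx n.+1 I.
  by have /andP[_ y1] := cantor_stage_unit yn; exfalso; lra.
by have <- : y = x by lra.
Qed.

(** Self-similarity: a point of the Cantor set is [z / 3] or [(z + 2) / 3], and a point off the set
    near [z] is carried back by the same contraction, at a third of the distance. The induction
    starts at [1 / 2], which is within 1 of all of [0, 1]. *)
Lemma cantor_set_empty_interior (x : R) n : 0 <= x <= 1 ->
  exists y, [/\ 0 <= y <= 1, `|y - x| <= 3 ^- n & ~ cantor_set R y].
Proof.
elim: n x => [|n IHn] x x01.
  exists (1 / 2); split; [lra| |].
    by rewrite expr0 invr1 ler_norml; apply/andP; split; lra.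
  by move=> /cantor_set_thirds[y /andP[y0 y1] []]; lra.
have [Dx|] := pselect (cantor_set R x); last first.
  by move=> nDx; exists x; rewrite subrr normr0 invr_ge0 exprn_ge0.
have [z /andP[z0 z1] xz] := cantor_set_thirds Dx.
have [|y [/andP[y0 y1] yz nDy]] := IHn z; first exact/andP.
have dist (u : R) : `|u - z| / 3 = `|(u - z) / 3|.
  by rewrite normrM (ger0_norm (_ : 0 <= 3^-1)) ?invr_ge0.
have yz3 : `|(y - z) / 3| <= 3 ^- n.+1.
  by rewrite -dist exprSr invfM ler_pdivrMr// -mulrA mulVf// mulr1.
case: xz => ->.
  exists (y / 3); split; [by apply/andP; split; lra| |].
    by rewrite -mulrBl.
  by move/cantor_set_third => /(_ y1).
exists ((y + 2) / 3); split; [by apply/andP; split; lra| |].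
  by rewrite -mulrBl opprD addrACA subrr addr0.
by move/cantor_set_two_thirds => /(_ y0).
Qed.

End CantorSet.

(** The real Tietze theorem is applied to the real and imaginary parts; [p] below stands for either
    of them. *)
Lemma Tietze_cantor (R : realType) (g : CDelta R) :
  exists2 G : unit_itv R -> R[i]^o, continuous G & G \o @cantor_incl R = g.
Proof.
have closedD := @cantor_set_closed R.
have ext (p : R[i] -> R) : (forall x : cantor_set R, p (g y) @[y --> x] --> p (g x)) ->
    (forall x, `|p (g x)| <= rnorm g) ->
    exists2 u : R -> R, continuous u & forall t, u (val t) = p (g t).
  move=> pg pb.
  (* Tietze takes a function on all of [R], hence the default value 0 off the Cantor set; continuity
     is asked only within that set. *)
  pose f (x : R) := if pselect (cantor_set R x) is left Dx
    then p (g (exist _ x (mem_set Dx))) else 0.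
  have fE t : f (val t) = p (g t).
    rewrite /f; case: pselect => [Dt|]; last by have := set_valP t.
    by congr (p (g _)); apply/val_inj.
  (* The extension theorem wants a positive bound, and [g] may be 0. *)
  have M0 : 0 < rnorm g + 1 by rewrite ltr_wpDl ?rnorm_ge0.
  have cf : {within cantor_set R, continuous f}.
    apply/subspace_sigL_continuousP => x.
    rewrite (_ : sigL _ f = p \o g); first exact: pg.
    by apply/funext => t; exact: fE.
  have fM x : cantor_set R x -> `|f x| <= rnorm g + 1.
    move=> Dx; have := fE (exist _ x (mem_set Dx)) => /= ->.
    by rewrite (le_trans (pb _))// lerDl.
  have nR : normal_space R by apply: pseudometric_normal.
  have [u [fu cu _]] := continuous_bounded_extension nR closedD M0 cf fM.
  exists u; first exact: cu.
  by move=> t; rewrite -fE fu//; exact: valP.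
have cg := @contfun_continuous _ _ _ g.
have [t|t|u cu uE] := ext (@complex.Re R).
- exact: (@cvg_Re _ _ (nbhs t) _ _ _ (cg t)).
- exact: le_trans (Re_le_rnorm _) (contfun_le _ _).
have [t|t|v cv vE] := ext (@complex.Im R).
- exact: (@cvg_Im _ _ (nbhs t) _ _ _ (cg t)).
- exact: le_trans (Im_le_rnorm _) (contfun_le _ _).
exists (fun s => Complex (u (val s)) (v (val s))).
  have cval := @initial_continuous (unit_itv R) R set_val.
  move=> s; apply: (@cvg_ReIm _ _ (nbhs s)).
    exact: continuous_comp (cval s) (cu _).
  exact: continuous_comp (cval s) (cv _).
by apply/funext => t /=; rewrite uE vE; case: (g t).
Qed.

(** * Traces on the Cantor set *)

Section XEbasics.
Variables (R : realType) (E : normedModType R[i]) (J : {linear E -> CDelta R}).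
Implicit Types f g : XE J.

Lemma XE_le f s : rnorm (f s) <= rnorm f.
Proof. exact: contfun_le. Qed.

Lemma XE_norm_le f (M : R) : 0 <= M ->
  (forall s, rnorm (f s) <= M) -> rnorm f <= M.
Proof. exact: contfun_norm_le. Qed.

Lemma XED f g s : (f + g) s = f s + g s. Proof. by []. Qed.
Lemma XEZ k f s : (k *: f) s = k * f s. Proof. by []. Qed.

Lemma XE_eq f g : (forall s, f s = g s) -> f = g.
Proof. by move=> fg; do 2!apply/val_inj; apply/funext. Qed.

Lemma XE_ex (g : unit_itv R -> R[i]^o) (e : E) : continuous g ->
  (forall t, g (cantor_incl t) = J e t) -> {f : XE J | forall s, f s = g s}.
Proof.
move=> cg ge.
have g1 : g \in @contfun_pred R (unit_itv R) by exact/asboolP.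
have g2 : Contfun (@unit_itv_compact R) g g1 \in XE_pred J.
  by apply/asboolP; exists e; apply/funext => t; exact: ge.
by exists (MkXE g2).
Qed.

Lemma XE_continuous f : continuous (f : unit_itv R -> R[i]^o).
Proof. exact: contfun_continuous. Qed.

Hypothesis J_isometry : forall x : E, `|J x| = `|x|.

(** A preimage under [J] picked by choice; [trace_uniq] makes it canonical, an isometry being
    injective. *)
Definition trace f : E := projT1 (cid (asboolW (XEP f))).

Lemma traceE f t : f (cantor_incl t) = J (trace f) t.
Proof. by rewrite /trace; case: cid => e /= /(congr1 (@^~ t)). Qed.

Lemma trace_uniq f e : (forall t, f (cantor_incl t) = J e t) -> trace f = e.
Proof.
move=> fe; apply/eqP; rewrite -subr_eq0 -normr_eq0 -J_isometry linearB normr_eq0.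
by rewrite subr_eq0; apply/eqP/val_inj/funext => t /=; rewrite -traceE fe.
Qed.

Lemma trace_linear : linear trace.
Proof.
move=> k f g; apply: trace_uniq => t; rewrite linearP.
by rewrite XED XEZ !traceE.
Qed.

Lemma trace0 : trace 0 = 0.
Proof. by apply: trace_uniq => t; rewrite linear0. Qed.

Lemma traceZ k f : trace (k *: f) = k *: trace f.
Proof. by rewrite -[k *: f]addr0 trace_linear trace0 addr0. Qed.

Lemma trace_norm_le f : rnorm (trace f) <= rnorm f.
Proof.
rewrite /rnorm -J_isometry -/(rnorm _) -/(rnorm f).
apply: contfun_norm_le => [|t]; first exact: rnorm_ge0.
by rewrite -traceE XE_le.
Qed.

Lemma lift_ex (e : E) : exists f : XE J, trace f = e.
Proof.
have [G cG GE] := Tietze_cantor (J e).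
have [t|f fE] := @XE_ex G e cG; first by rewrite -GE.
exists f; apply: trace_uniq => t; by rewrite fE -GE.
Qed.

End XEbasics.

Lemma rnorm_lim_le (R : realType) (V : normedModType R[i]) (T : Type)
    (F : set_system T) {FF : ProperFilter F} (f : T -> V) (l : V) (M : R) :
  f @ F --> l -> F [set x | rnorm (f x) <= M] -> rnorm l <= M.
Proof.
move=> /cvg_rnormP fl fM; apply/ler_addgt0Pr => e e0.
have [x [/= fx fxM]] := filter_ex (filterI (fl _ e0) fM).
by rewrite -[l](subrK (f x)) (le_trans (rnormD _ _))// addrC lerD// ltW.
Qed.

(** * Embedding E in the bidual of XE *)

Section Cutoffs.
Variables (R : realType) (E : normedModType R[i]) (J : {linear E -> CDelta R}).
Hypothesis J_isometry : forall x : E, `|J x| = `|x|.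
Implicit Types (f g x : XE J) (h v : unit_itv R -> R).

(** Each [h] indexes the neighbourhood of the Cantor set where [h <= 1]; the margin [m < 1] gives a
    cutoff room to descend from 1 to 0. *)
Definition below1_on_cantor : set (unit_itv R -> R) :=
  [set h | continuous h /\
    exists2 m : R, m < 1 & forall t, h (cantor_incl t) <= m].

Definition cutoffs g h : set (XE J) :=
  [set x | exists v, [/\ forall s, 0 <= v s <= 1,
    forall s, x s = (v s)%:C%C * g s,
    forall s, 1 < h s -> v s = 0 &
    forall t, v (cantor_incl t) = 1]].

Lemma cutoffs_nonempty g h : below1_on_cantor h -> cutoffs g h !=set0.
Proof.
move=> [ch [m m1 hm]].
(* [(1 - h) / (1 - m)] truncated to [0, 1]: it is 1 where [h <= m] and 0 where [h >= 1]. *)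
pose v := (fun=> 0 : R) \max ((fun=> 1) \min (fun s => (1 - h s) / (1 - m))).
have cv : continuous v.
  move=> s; apply: continuous_max; first exact: cst_continuous.
  apply: continuous_min; first exact: cst_continuous.
  apply: (@cvgM _ _ (nbhs s)); last exact: cst_continuous.
  by apply: (@cvgB _ _ _ (nbhs s)); [exact: cst_continuous|exact: ch].
have vD t : v (cantor_incl t) = 1.
  rewrite /v /= min_l ?max_r// lter_pdivlMr ?subr_gt0// mul1r lerD2l lerN2.
  exact: hm.
have [||x xE] := @XE_ex _ _ J (fun s => (v s)%:C%C * g s) (trace g).
- move=> s; apply: (@cvgM _ _ (nbhs s)); last exact: XE_continuous.
  by apply: (@cvg_ReIm _ _ (nbhs s)); [exact: cv|exact: cst_continuous].
- by move=> t; rewrite vD mul1r -traceE.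
exists x, v; split => //.
- move=> s; rewrite /v /= le_max lexx/= ge_max ler01/=.
  by rewrite ge_min lexx.
- move=> s h1; rewrite /v /= max_l// ge_min; apply/orP; right.
  by rewrite ler_pdivrMr ?subr_gt0// mul0r subr_le0 ltW.
Qed.

Lemma cutoffs_le g h x : cutoffs g h x -> rnorm x <= rnorm g.
Proof.
move=> [v [v01 xE _ _]]; apply: XE_norm_le => [|s]; first exact: rnorm_ge0.
have /andP[v0 v1] := v01 s.
rewrite xE rnormM rnormR ger0_norm// -[leRHS]mul1r.
by rewrite ler_pM ?rnorm_ge0 ?XE_le.
Qed.

Lemma trace_cutoffs g h x : cutoffs g h x -> trace x = trace g.
Proof.
move=> [v [_ xE _ vD]]; apply: trace_uniq => // t.
by rewrite xE vD mul1r traceE.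
Qed.

(** The index [h \max k] stands for the intersection of two neighbourhoods, so the family is
    directed; along it the supports shrink to the Cantor set. *)
Lemma cutoffs_filter g :
  ProperFilter (filter_from below1_on_cantor (cutoffs g)).
Proof.
apply: filter_from_proper; last exact: cutoffs_nonempty.
apply: filter_from_filter.
  exists (cst 0); split; first by move=> s; exact: cst_continuous.
  by exists 0 => //; exact: ltr01.
move=> h k [ch [m m1 hm]] [ck [n n1 kn]].
exists (h \max k).
  split; first by move=> s; apply: continuous_max; [exact: ch|exact: ck].
  exists (Num.max m n); first by rewrite gt_max m1.
  by move=> t; rewrite /= ge_max !le_max hm kn orbT.
move=> x [v [v01 xE hv vD]]; split; exists v; split => // s h1; apply: hv;
  by rewrite /= lt_max h1 ?orbT.
Qed.

(** Pointwise, [f + a *: x] is the convex combination of [f] and [f + a *: g] with weight [v]. Near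
    the Cantor set both are at most [N + e]; where the second one is larger, [v] vanishes and only
    [f] remains. *)
Lemma cutoffs_perturb f g (a : R[i]) (N e : R) : 0 < e -> rnorm f <= N ->
  rnorm (trace f + a *: trace g) <= N ->
  exists2 h, below1_on_cantor h &
    forall x, cutoffs g h x -> rnorm (f + a *: x) <= N + e.
Proof.
move=> e0 fN fgN.
have N0 : 0 <= N := le_trans (rnorm_ge0 _) fN.
have M0 : 0 < N + e by rewrite ltr_wpDl.
(* This index exceeds 1 exactly where [f + a *: g] exceeds [N + e]; on the Cantor set it is at most
   [N / (N + e) < 1]. *)
exists (fun s => rnorm ((f + a *: g) s) / (N + e)).
  split.
    move=> s; apply: (@cvgM _ _ (nbhs s)); last exact: cst_continuous.
    apply: (@cvg_rnorm _ _ _ (nbhs s)); exact: XE_continuous.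
  exists (N / (N + e)); first by rewrite ltr_pdivrMr// mul1r ltrDl.
  move=> t; rewrite ler_pM2r ?invr_gt0// (le_trans _ fgN)// traceE.
  by rewrite addrC trace_linear// -/(rnorm _) addrC /rnorm -J_isometry contfun_le.
move=> x [v [v01 xE hv _]]; apply: XE_norm_le => [|s]; first exact: ltW.
have [/hv v0|] := ltP 1 (rnorm ((f + a *: g) s) / (N + e)).
  rewrite XED XEZ xE v0 mul0r mulr0 addr0.
  by rewrite (le_trans (XE_le _ _))// (le_trans fN)// lerDl ltW.
rewrite ler_pdivrMr// mul1r => fgs; have /andP[v0 v1] := v01 s.
have -> : (f + a *: x) s =
    (1 - v s)%:C%C * f s + (v s)%:C%C * (f + a *: g) s.
  by rewrite !XED !XEZ xE rmorphB /=; ring.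
apply: le_trans (rnormD _ _) _; rewrite !rnormM !rnormR.
rewrite !ger0_norm ?subr_ge0//.
have fs := le_trans (XE_le f s) fN.
have : (1 - v s) * rnorm (f s) <= (1 - v s) * (N + e).
  by rewrite ler_wpM2l ?subr_ge0// (le_trans fs)// lerDl ltW.
have : v s * rnorm ((f + a *: g) s) <= v s * (N + e) by rewrite ler_wpM2l.
lra.
Qed.

(* The M-ideal property of the functions vanishing on the Cantor set embeds E
   isometrically in the bidual of XE. *)
Lemma bidual_embedding (e : E) :
  exists L : dual_space (dual_space (XE J)),
    (forall (phi : dual_space (XE J)) c,
      (forall f, trace f = e -> phi f = c) -> L phi = c) /\
    (forall (phi : dual_space (XE J)) f a N, rnorm f <= N ->
      rnorm (trace f + a *: e) <= N -> rnorm (phi f + a * L phi) <= rnorm phi * N).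
Proof.
have [g gE] := lift_ex J_isometry e.
have [U [UU BU]] := ultraFilterLemma (cutoffs_filter g).
have Ucut h : below1_on_cantor h -> U (cutoffs g h).
  by move=> hD; apply: BU; exists h.
have U0 : U (cutoffs g (cst 0)).
  apply: Ucut; split; first by move=> s; exact: cst_continuous.
  by exists 0 => //; exact: ltr01.
pose L (phi : dual_space (XE J)) : R[i]^o := lim (phi x @[x --> U]).
have cvgL (phi : dual_space (XE J)) : phi x @[x --> U] --> L phi.
  apply: (@ultra_cvg_complex _ _ _ _ _ (rnorm phi * rnorm g)).
  apply: filterS U0 => x /= /cutoffs_le xg.
  by rewrite (le_trans (bdop_le _ _))// ler_wpM2l ?rnorm_ge0.
have limL (phi : XE J -> R[i]^o) (l : R[i]^o) :
    phi x @[x --> U] --> l -> lim (phi x @[x --> U]) = l.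
  exact: cvg_lim.
have linL : linear L.
  move=> k phi psi; apply: limL.
  exact: (cvgD (cvgZl_tmp (cvgL phi)) (cvgL psi)).
have keyL (phi : dual_space (XE J)) f a N : rnorm f <= N ->
    rnorm (trace f + a *: e) <= N -> rnorm (phi f + a * L phi) <= rnorm phi * N.
  move=> fN fgN; have N0 := le_trans (rnorm_ge0 _) fN.
  apply/ler_addgt0Pr => d d0.
  have p0 : 0 < rnorm phi + 1 by rewrite ltr_wpDl ?rnorm_ge0.
  (* An error of this size, multiplied by [rnorm phi], stays below [d]; the added 1 covers
     [phi = 0]. *)
  have dp : 0 < d / (rnorm phi + 1) by rewrite divr_gt0.
  rewrite -gE in fgN; have [h hD hP] := cutoffs_perturb dp fN fgN.
  apply: (@rnorm_lim_le _ _ _ U _ (fun x => phi f + a * phi x)).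
    exact: (cvgD (cvg_cst _) (cvgZl_tmp (cvgL phi))).
  apply: filterS (Ucut _ hD) => x /hP fx /=.
  have -> : phi f + a * phi x = phi (f + a *: x) by rewrite linearD linearZ.
  rewrite (le_trans (bdop_le _ _))// (le_trans (ler_wpM2l (rnorm_ge0 _) fx))//.
  rewrite mulrDr lerD2l mulrA ler_pdivrMr// mulrC ler_wpM2l ?(ltW d0)//.
  by rewrite lerDl.
have bL : L \in @bdop_pred R (dual_space (XE J)) R[i]^o.
  apply: bounded_linear_bdop => //; exists (rnorm e) => phi.
  (* The key estimate at [f = 0], [a = 1] bounds [L] by the norm of [e]. *)
  have := @keyL phi 0 1 (rnorm e); rewrite rnorm0 => /(_ (rnorm_ge0 _)).
  rewrite linear0 mul1r add0r mulrC; apply.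
  by rewrite (_ : trace 0 = 0) ?add0r ?scale1r//; apply: trace_uniq => // t; rewrite linear0.
exists (Bdop bL); split=> [phi c phic|//].
(* All cutoffs of [g] have trace [e], so [phi] is constant along [U]. *)
apply: limL; apply: (@cvg_near_cst _ _ _ _ U).
apply: filterS U0 => x /trace_cutoffs xg; apply: phic.
by rewrite xg.
Qed.

End Cutoffs.

(** * Hermitian projections on the dual of X(l2) *)

Section SequenceSpaceL2.
Variable R : realType.
Implicit Types x y : l2 R.

Lemma l2D x y n : (x + y) n = x n + y n. Proof. by []. Qed.
Lemma l2Z k x n : (k *: x) n = k * x n. Proof. by []. Qed.

Lemma l2_coord_le x n : rnorm (x n) <= rnorm x.
Proof.
rewrite [leRHS]/rnorm lp_normrE /= -lee_fin fineK ?lp_norm_fin//.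
exact: lp_norm_ub (ler1n R 2) x n.
Qed.

Lemma l2_norm_eq x y : (forall n, rnorm (x n) = rnorm (y n)) -> rnorm x = rnorm y.
Proof.
move=> xy; rewrite /rnorm !lp_normrE /=; congr fine; rewrite /lp_norm.
by congr Lnorm; apply/funext => n; rewrite xy.
Qed.

Lemma l2_delta_subproof (n : nat) :
  (fun k => (k == n)%:R : R[i]^o) \in lp_pred (2%:R : R).
Proof.
rewrite unfold_in /lp_pred (lp_normE (ler1n R 2)); apply: poweR_lty.
rewrite (@nneseries_split _ _ 0 n.+1) => [|k _]; last by rewrite lee_fin powR_ge0.
rewrite add0n [X in (_ + X)%E]eseries0 => [|k nk _].
  by rewrite adde0 sumEFin ltry.
by rewrite gtn_eqF// [rnorm _]rnorm0 powR0// pnatr_eq0.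
Qed.

Definition l2_delta n : l2 R := Lp (ler1n R 2) (l2_delta_subproof n).

Lemma l2_deltaE n k : l2_delta n k = (k == n)%:R. Proof. by []. Qed.

End SequenceSpaceL2.

(* The hypothesis is |al + be w|^2 <= |al|^2 for al = 1 + ib, be = -2ib and
   w = x + ib, in the form left by simplification. *)
Lemma rotation_ineq (R : realFieldType) (b x : R) :
  (1 + (0 * x - - (2 * b) * b)) ^+ 2 + (b + (0 * b + - (2 * b) * x)) ^+ 2 <=
    1 ^+ 2 + b ^+ 2 -> b = 0.
Proof.
move=> H; apply/eqP; rewrite -sqrf_eq0 eq_le sqr_ge0 andbT.
have := sqr_ge0 (b ^+ 2); have := sqr_ge0 (b - 2 * b * x).
move: H; rewrite !expr2; nra.
Qed.

Section DualProjections.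
Variables (R : realType) (J : {linear l2 R -> CDelta R}).
Hypothesis J_isometry : forall x : l2 R, `|J x| = `|x|.
Local Notation X := (XE J).

Lemma trace_coord_subproof n :
  (fun f : X => trace f n : R[i]^o) \in @bdop_pred R X R[i]^o.
Proof.
apply: bounded_linear_bdop.
  by move=> k f g; rewrite trace_linear.
exists 1 => f; rewrite mul1r (le_trans (l2_coord_le _ _))//.
exact: trace_norm_le.
Qed.

Definition trace_coord n : dual_space X := Bdop (trace_coord_subproof n).

Lemma trace_coordE n f : trace_coord n f = trace f n. Proof. by []. Qed.

Definition bidual_delta n : dual_space (dual_space X) :=
  projT1 (cid (bidual_embedding J_isometry (l2_delta R n))).

(** Biorthogonality: [trace_coord m] sees only the trace, so the first clause of [bidual_embedding]
    evaluates it at a unit vector. It makes the [coord_proj n] mutually orthogonal projections. *)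
Lemma bidual_delta_trace_coord n m : bidual_delta n (trace_coord m) = (m == n)%:R.
Proof.
rewrite /bidual_delta; case: cid => L /= [LE _]; apply: LE => f fE.
by rewrite trace_coordE fE l2_deltaE.
Qed.

Lemma bidual_delta_le n (phi : dual_space X) f a N : rnorm f <= N ->
  rnorm (trace f + a *: l2_delta R n) <= N ->
  rnorm (phi f + a * bidual_delta n phi) <= rnorm phi * N.
Proof. rewrite /bidual_delta; case: cid => L /= [_]; exact. Qed.

Lemma coord_proj_subproof n :
  (fun phi => (bidual_delta n phi : R[i]) *: trace_coord n)
    \in @bdop_pred R (dual_space X) (dual_space X).
Proof.
apply: bounded_linear_bdop.
  by move=> k phi psi; rewrite linearP scalerDl scalerA.
exists (rnorm (bidual_delta n) * rnorm (trace_coord n)) => phi.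
by rewrite rnormZ mulrAC ler_wpM2r ?rnorm_ge0 ?bdop_le.
Qed.

Definition coord_proj n : bdop (dual_space X) (dual_space X) :=
  Bdop (coord_proj_subproof n).

Lemma coord_projE n phi : coord_proj n phi = (bidual_delta n phi : R[i]) *: trace_coord n.
Proof. by []. Qed.

Lemma coord_proj_trace_coord n m :
  coord_proj n (trace_coord m) = ((m == n)%:R : R[i]) *: trace_coord n.
Proof. by rewrite coord_projE bidual_delta_trace_coord. Qed.

(** Coordinate [n] of [x] is multiplied by [al + be] and every other one by [al], factors of equal
    modulus. *)
Lemma l2_rotation_le n (al be : R[i]) (x : l2 R) :
  rnorm (al + be : R[i]^o) = rnorm (al : R[i]^o) ->
  rnorm (al *: x + (be * x n) *: l2_delta R n) = rnorm (al : R[i]^o) * rnorm x.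
Proof.
move=> alE; rewrite -rnormZ; apply: l2_norm_eq => k.
rewrite l2D !l2Z l2_deltaE; have [->|_] := eqVneq k n; last first.
  by rewrite mulr0 addr0.
by rewrite mulr1 -mulrDl !rnormM alE.
Qed.

(* alpha^-1 (alpha I + beta P_n) is the adjoint of multiplying the n-th
   coordinate by a unimodular number. *)
Lemma coord_rotation_le n (al be : R[i]) (phi : dual_space X) :
  rnorm (al + be : R[i]^o) = rnorm (al : R[i]^o) ->
  rnorm (al *: phi + be *: coord_proj n phi) <= rnorm (al : R[i]^o) * rnorm phi.
Proof.
move=> alE; apply: bdop_norm_le => [|f]; first by rewrite mulr_ge0 ?rnorm_ge0.
have fN : rnorm (al *: f) <= rnorm (al : R[i]^o) * rnorm f by rewrite rnormZ.
have tN : rnorm (trace (al *: f) + (be * trace f n) *: l2_delta R n) <=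
    rnorm (al : R[i]^o) * rnorm f.
  have := l2_rotation_le n (trace f) alE.
  rewrite traceZ//.
  move=> ->.
  by rewrite ler_wpM2l ?rnorm_ge0// trace_norm_le.
(* With coefficient [be * trace f n], the left side is the value at [f] of
   [al *: phi + be *: coord_proj n phi]; what remains is reordering factors. *)
have := bidual_delta_le phi fN tN.
rewrite -[be * _ * _]mulrA.
rewrite [X in be * X]mulrC.
rewrite [rnorm phi * _]mulrA [rnorm phi * _]mulrC.
rewrite [phi (al *: f)]linearZ.
exact.
Qed.

Lemma coord_proj_hermitian n : hermitian_op (coord_proj n).
Proof.
move=> _ [phi [Phi [phi1 Phi1 Phiphi ->]]] /=; apply: Im0_real.
set w := Phi _; set b := complex.Im w.
(* Here [al + be] is the conjugate of [al], so [coord_rotation_le] applies and gives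
   [|al + be * w| <= |al|], which fails unless [b = 0]. *)
pose al : R[i] := Complex 1 b; pose be : R[i] := Complex 0 (- (2 * b)).
have alE : rnorm (al + be : R[i]^o) = rnorm (al : R[i]^o).
  apply/eqP; rewrite -(@eqrXn2 _ 2)// ?rnorm_ge0// !rnorm_sqr /=.
  by apply/eqP; ring.
have PhiE : Phi (al *: phi + be *: coord_proj n phi) = al + be * w.
  rewrite bdopD (bdopZ Phi al phi) (bdopZ Phi be (coord_proj n phi)) Phiphi.
  by rewrite [al *: 1]mulr1.
have := le_trans (bdop_le Phi _)
  (ler_wpM2l (rnorm_ge0 Phi) (@coord_rotation_le n al be phi alE)).
rewrite /(rnorm Phi) Phi1 /(rnorm phi) phi1 /= !mulr1 mul1r.
rewrite PhiE => H.
have : rnorm (al + be * w : R[i]^o) ^+ 2 <= rnorm (al : R[i]^o) ^+ 2.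
  by rewrite ler_sqr ?nnegrE ?rnorm_ge0.
rewrite !rnorm_sqr /al /be.
have -> : w = Complex (complex.Re w) b by rewrite /b; case: (w).
exact: rotation_ineq.
Qed.

(** The coefficients run over all of [nat], so that sums of different lengths can be padded with
    zeros and added. *)
Definition diag_span : set (bdop (dual_space X) (dual_space X)) :=
  [set T | exists N (c : nat -> R[i]), (forall i, c i \is Num.real) /\
    T = \sum_(i < N) c i *: coord_proj i].

Lemma diag_span_widen N M (c : nat -> R[i]) : (N <= M)%N ->
  \sum_(i < N) c i *: coord_proj i =
  \sum_(i < M) (if (i < N)%N then c i else 0) *: coord_proj i.
Proof.
move=> NM; rewrite (big_ord_widen M (fun i => c i *: coord_proj i))// big_mkcond.
by apply: eq_bigr => i _; case: ifP => // _; rewrite scale0r.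
Qed.

Lemma diag_span_subspace : subspace_over (real_scalars R) diag_span.
Proof.
split.
- by exists 0%N, (fun=> 0); split=> [i|]; rewrite ?rpred0 ?big_ord0.
- move=> _ _ [N [c [cr ->]]] [M [d [dr ->]]].
  exists (maxn N M), (fun i => (if (i < N)%N then c i else 0) +
    (if (i < M)%N then d i else 0)); split=> [i|].
    by rewrite rpredD//; case: ifP => // _; rewrite rpred0.
  rewrite (diag_span_widen c (leq_maxl N M)) (diag_span_widen d (leq_maxr N M)).
  by rewrite -big_split/=; apply: eq_bigr => i _; rewrite scalerDl.
- move=> k _ kr [N [c [cr ->]]]; exists N, (fun i => k * c i); split=> [i|].
    by rewrite rpredM.
  by rewrite scaler_sumr; apply: eq_bigr => i _; rewrite scalerA.
Qed.

Lemma diag_span_hermitian T : diag_span T -> hermitian_op T.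
Proof.
move=> [N [c [cr ->]]] w [phi [Phi [phi1 Phi1 Phiphi ->]]] /=.
have -> : Phi ((\sum_(i < N) c i *: coord_proj i) phi) =
    \sum_(i < N) c i * Phi (coord_proj i phi).
  rewrite bdop_sumE (big_morph Phi (bdopD Phi) (linear0 _)).
  by apply: eq_bigr => i _; exact: bdopZ.
apply: rpred_sum => i _; rewrite rpredM//.
by apply: (@coord_proj_hermitian i); exists phi, Phi.
Qed.

Lemma scale_coord_proj_trace_coord (c : R[i]) i m :
  (c *: coord_proj i) (trace_coord m) = (if m == i then c else 0) *: trace_coord m.
Proof.
have -> : (c *: coord_proj i) (trace_coord m) = (c * (m == i)%:R) *: trace_coord i.
  exact: etrans (congr1 ( *:%R c) (coord_proj_trace_coord i m)) (scalerA _ _ _).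
by case: eqVneq => [->|_]; rewrite ?mulr1 // mulr0 !scale0r.
Qed.

Lemma diag_span_trace_coord N (c : nat -> R[i]) m :
  (\sum_(i < N) c i *: coord_proj i) (trace_coord m) =
  (if (m < N)%N then c m else 0) *: trace_coord m.
Proof.
rewrite bdop_sumE; under eq_bigr do rewrite scale_coord_proj_trace_coord.
rewrite -scaler_suml; congr (_ *: _); rewrite -big_mkcond/=.
case: ifP => mN; first by rewrite (big_pred1 (Ordinal mN)).
by rewrite big_pred0// => i; apply: contraFF mN => /eqP ->.
Qed.

Lemma diag_span_finite_rank T : diag_span T -> finite_rank T.
Proof.
move=> [N [c [cr ->{T}]]]; set T := \sum_(i < _) _.
(* The generators have to lie in the range of [T]; [trace_coord i] itself need not, since [c i] may
   be 0. *)
exists N, (fun i => T (trace_coord i)); split; first by move=> i; exists (trace_coord i).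
move=> _ [phi _ <-]; exists (fun i => bidual_delta i phi); split => //.
rewrite bdop_sumE; apply: eq_bigr => i _.
rewrite diag_span_trace_coord ltn_ord.
apply: etrans (scalerA (c i) (bidual_delta i phi) (trace_coord i)) _.
by rewrite mulrC; apply/esym; exact: scalerA.
Qed.

Lemma trace_coord_neq0 n : trace_coord n != 0.
Proof.
apply: contra_eqN (bidual_delta_trace_coord n n) => /eqP ->.
by rewrite linear0 eqxx eq_sym oner_neq0.
Qed.

(** Each element of the span kills [trace_coord m] for large [m]. Finitely many generators share
    such an [m], yet [coord_proj m] fixes [trace_coord m]. *)
Lemma diag_span_infinite_dim : ~ finite_dim_over (real_scalars R) diag_span.
Proof.
move=> [n [v [vS vgen]]].
have /choice[M MP] : forall i, exists M, forall m, (M <= m)%N ->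
    v i (trace_coord m) = 0.
  move=> i; have [N [c [_ ->]]] := vS i; exists N => m Nm.
  by rewrite diag_span_trace_coord ltnNge Nm scale0r.
pose m := (\max_(i < n) M i)%N.
have [|c [_ cE]] := vgen (coord_proj m).
  exists m.+1, (fun i => (i == m)%:R); split; first by move=> i; exact: rpred_nat.
  rewrite big_ord_recr/= eqxx scale1r big1 ?add0r// => i _.
  by rewrite ltn_eqF ?scale0r.
have Em : coord_proj m (trace_coord m) = trace_coord m.
  by rewrite coord_proj_trace_coord eqxx scale1r.
move/eqP: (trace_coord_neq0 m); apply; rewrite -[LHS]Em cE bdop_sumE big1// => i _.
apply: etrans (scaler0 _ (c i)); congr (c i *: _).
exact/MP/(leq_bigmax i).
Qed.

End DualProjections.

(** * Copies of l1 *)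

Section SequenceSpaceL1.
Variable R : realType.
Implicit Types x y : l1 R.

Lemma l1D x y n : (x + y) n = x n + y n. Proof. by []. Qed.
Lemma l1N x n : (- x) n = - x n. Proof. by []. Qed.

Lemma lp1_normE (a : nat -> R[i]^o) :
  lp_norm 1 a = (\sum_(0 <= k <oo) (rnorm (a k))%:E)%E.
Proof.
rewrite (lp_normE (lexx 1)) invr1 poweRe1 => [|].
  by apply: eq_eseriesr => k _; rewrite powRr1// rnorm_ge0.
by apply: nneseries_ge0 => k _ _; rewrite lee_fin powR_ge0.
Qed.

Lemma l1_partial_le x n : \sum_(0 <= k < n) rnorm (x k) <= rnorm x.
Proof.
rewrite [leRHS]/rnorm lp_normrE /= -lee_fin fineK ?lp_norm_fin// lp1_normE.
rewrite -sumEFin; apply: nneseries_lim_ge => k _ _.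
by rewrite lee_fin rnorm_ge0.
Qed.

Lemma lp1_norm_le (a : nat -> R[i]^o) (M : R) :
  (forall n, \sum_(0 <= k < n) rnorm (a k) <= M) -> (lp_norm 1 a <= M%:E)%E.
Proof.
move=> aM; rewrite lp1_normE; apply: lime_le.
  by apply: is_cvg_nneseries => k _ _; rewrite lee_fin rnorm_ge0.
by apply: nearW => n; rewrite sumEFin lee_fin.
Qed.

Lemma l1_norm_le x (M : R) :
  (forall n, \sum_(0 <= k < n) rnorm (x k) <= M) -> rnorm x <= M.
Proof.
move=> xM; rewrite /rnorm lp_normrE /= -lee_fin fineK ?lp_norm_fin//.
exact: lp1_norm_le.
Qed.

Lemma l1_ex (a : nat -> R[i]^o) (M : R) :
  (forall n, \sum_(0 <= k < n) rnorm (a k) <= M) -> {x : l1 R | lp_fun x = a}.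
Proof.
move=> aM; have al : a \in lp_pred 1.
  by rewrite unfold_in /lp_pred (le_lt_trans (lp1_norm_le aM))// ltry.
by exists (Lp (lexx 1) al).
Qed.

Lemma l1_tail_lt x (e : R) : 0 < e ->
  exists n, rnorm x - \sum_(0 <= k < n) rnorm (x k) < e.
Proof.
move=> e0; apply/not_existsP => tail.
have : rnorm x <= rnorm x - e.
  apply: l1_norm_le => n; rewrite lerBrDr addrC -lerBrDr leNgt.
  exact/negP/tail.
by rewrite leNgt gtrBl e0.
Qed.

Lemma l1_coord_le x n : rnorm (x n) <= rnorm x.
Proof.
apply: le_trans (l1_partial_le x n.+1); rewrite big_nat_recr//= lerDr.
by apply: sumr_ge0 => k _; rewrite rnorm_ge0.
Qed.

End SequenceSpaceL1.

(** * Operators bounded below *)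

Section BoundedBelow.
Variables (R : realType) (U V : normedModType R[i]).

(** Linearity turns the lower bound into [cfB]: [f] is injective on [A] and its inverse is Lipschitz
    with constant [c^-1]. *)
Lemma bounded_below_isomorphism (f : bdop U V) (A : set U) (c : R) : 0 < c ->
  subspace_over (complex_scalars R) A ->
  (forall x, A x -> c * rnorm x <= rnorm (f x)) ->
  isomorphism_between A [set f x | x in A] f.
Proof.
move=> c0 [A0 AD AZ] cf.
have cfB x y : A x -> A y -> rnorm (x - y) <= c^-1 * rnorm (f x - f y).
  move=> Ax Ay; rewrite ler_pdivlMl//.
  have -> : f x - f y = f (x - y) by rewrite linearB.
  by apply: cf; apply: AD => //; rewrite -scaleN1r; exact: AZ.
have finj x y : A x -> A y -> f x = f y -> x = y.
  move=> Ax Ay fxy; apply/eqP; rewrite -subr_eq0; apply/eqP/rnorm_eq0/eqP.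
  rewrite eq_le rnorm_ge0 andbT (le_trans (cfB _ _ Ax Ay))//.
  by rewrite fxy subrr rnorm0 mulr0.
split.
  split; first by move=> x Ax; exists x.
    by move=> x y /set_mem Ax /set_mem Ay; exact: finj.
  by [].
(* The inverse gets the default value 0 off the image of [A]. *)
have /choice[S SP] : forall y, exists x, [set f x | x in A] y -> A x /\ f x = y.
  move=> y; have [[x Ax fx]|nfA] := pselect ([set f x | x in A] y).
    by exists x.
  by exists 0.
have Sf y : [set f x | x in A] y -> A (S y) /\ f (S y) = y := @SP y.
exists S; split.
  move=> x /set_mem Ax; have [|ASx fSx] := Sf (f x); first by exists x.
  exact: finj.
apply/subspace_continuousP => y fAy; apply/cvg_rnormP => e e0.
have ce : 0 < c * e by rewrite mulr_gt0.
have /cvg_rnormP/(_ _ ce) := @cvg_id _ (nbhs y).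
rewrite !near_simpl near_withinE; apply: filterS => z yz fAz.
have [ASy fSy] := Sf y fAy; have [ASz fSz] := Sf z fAz.
by rewrite (le_lt_trans (cfB _ _ ASy ASz))// fSy fSz ltr_pdivrMl.
Qed.

Lemma range_subspace (f : bdop U V) : subspace_over (complex_scalars R) (range f).
Proof.
split; first by exists 0 => //; exact: linear0.
  by move=> _ _ [x _ <-] [y _ <-]; exists (x + y) => //; exact: linearD.
by move=> c _ _ [x _ <-]; exists (c *: x) => //; exact: linearZ.
Qed.

End BoundedBelow.

(* Coordinatewise limits along an ultrafilter replace the completeness of l1. *)
Lemma closed_range_l1 (R : realType) (Z : normedModType R[i])
    (f : bdop (l1 R) Z) (c : R) : 0 < c ->
  (forall x, c * rnorm x <= rnorm (f x)) -> closed (range f).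
Proof.
move=> c0 cf z clz.
pose B e : set (l1 R) := [set x | rnorm (z - f x) < e].
have BF : ProperFilter (filter_from [set e : R | 0 < e] B).
  apply: filter_from_proper.
    apply: filter_from_filter; first by exists 1; exact: ltr01.
    move=> e d e0 d0; exists (Num.min e d); first by rewrite /= lt_min e0.
    by move=> x; rewrite /B /= lt_min => /andP[].
  move=> e e0; have [|_ [[x _ <-] xe]] := clz [set y | rnorm (z - y) < e].
    by have /cvg_rnormP/(_ _ e0) := @cvg_id _ (nbhs z).
  by exists x.
have [U [UU BU]] := ultraFilterLemma BF.
have UB e : 0 < e -> U (B e) by move=> e0; apply: BU; exists e.
have Bdist e x y : B e x -> B e y -> rnorm (x - y) <= c^-1 * (e + e).
  move=> Bx By; rewrite ler_pdivlMl// (le_trans (cf _))//.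
  have -> : f (x - y) = (z - f y) - (z - f x).
    by rewrite linearB opprB [RHS]addrC addrA subrK.
  by rewrite (le_trans (rnormD _ _))// rnormN lerD// ltW.
have cvgU k : cvg ((fun x : l1 R => x k) @ U).
  apply: (@ultra_cvg_complex _ _ _ _ _ (c^-1 * (rnorm z + 1))).
  apply: filterS (UB 1 ltr01) => x Bx /=; apply: le_trans (l1_coord_le _ _) _.
  rewrite ler_pdivlMl// (le_trans (cf _))//.
  have -> : f x = z - (z - f x) by rewrite subKr.
  by rewrite (le_trans (rnormD _ _))// rnormN lerD// ltW.
pose b k : R[i]^o := lim ((fun x : l1 R => x k) @ U).
(* Passing to the limit in finitely many coordinates of [Bdist] bounds every partial sum of
   [b - x]. *)
have bB e x n : 0 < e -> B e x ->
    \sum_(0 <= k < n) rnorm (b k - x k) <= c^-1 * (e + e).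
  move=> e0 Bx.
  have : (fun y : l1 R => \sum_(0 <= k < n) rnorm (y k - x k)) @ U -->
      \sum_(0 <= k < n) rnorm (b k - x k).
    apply: cvg_big => [|k _]; first exact: add_continuous.
    by apply: cvg_rnorm; apply: cvgB; [exact: cvgU|exact: cvg_cst].
  move/cvgr_to_le; apply; apply: filterS (UB _ e0) => y By.
  exact: le_trans (l1_partial_le (y - x) n) (Bdist e y x By Bx).
have [x0 Bx0] := filter_ex (UB 1 ltr01).
(* So far only the difference [b - x0] is known to be summable, so the limit point is built as
   [d + x0]. *)
have [d dE] := l1_ex (fun n => bB 1 x0 n ltr01 Bx0).
exists (d + x0) => //; apply/eqP; rewrite eq_sym -subr_eq0; apply/eqP.
apply/rnorm_eq0/eqP; rewrite eq_le rnorm_ge0 andbT; apply/ler_addgt0Pr => e e0; rewrite add0r.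
have f1 : 0 < rnorm f * (c^-1 * 2) + 1.
  by rewrite ltr_wpDl// !mulr_ge0 ?rnorm_ge0// invr_ge0 ltW.
(* Chosen so that [h + rnorm f * (c^-1 * (h + h))] equals [e]. *)
pose h := e / (rnorm f * (c^-1 * 2) + 1).
have h0 : 0 < h by rewrite divr_gt0.
have [x Bx] := filter_ex (UB h h0).
have dx : rnorm (d + x0 - x) <= c^-1 * (h + h).
  apply: l1_norm_le => n; apply: le_trans (bB h x n h0 Bx).
  by apply: ler_sum => k _; rewrite l1D l1N l1D dE subrK.
have -> : z - f (d + x0) = (z - f x) - f (d + x0 - x).
  by rewrite linearB opprB addrA subrK.
rewrite (le_trans (rnormD _ _))// rnormN.
have := ler_wpM2l (rnorm_ge0 f) dx => /(le_trans (bdop_le _ _)) fx.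
rewrite (le_trans (lerD (ltW Bx) fx))//.
have -> : h + rnorm f * (c^-1 * (h + h)) = h * (rnorm f * (c^-1 * 2) + 1).
  by ring.
by rewrite /h divfK// gt_eqF.
Qed.

Lemma fixes_l1_of_bounded_below (R : realType) (Z : normedModType R[i])
    (T : bdop Z Z) (f : bdop (l1 R) Z) (c d : R) : 0 < c -> 0 < d ->
  (forall x, c * rnorm x <= rnorm (f x)) ->
  (forall x, d * rnorm (f x) <= rnorm (T (f x))) ->
  fixes_copy_of_l1 T.
Proof.
move=> c0 d0 cf dT; exists (range f); split.
- exact: range_subspace.
- exact: closed_range_l1 cf.
- by exists f; apply: bounded_below_isomorphism c0 _ _ => // ; split.
- apply: bounded_below_isomorphism d0 _ _; first exact: range_subspace.
  by move=> _ [x _ <-].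
Qed.

(** * Series with coefficients in l1 *)

Section L1Series.
Variable R : realType.
Implicit Types (x y : l1 R) (b : nat -> R).

Lemma l1_dominated_cvg x (u : nat -> R) :
  (forall k, `|u k| <= rnorm (x k)) -> cvgn (fun n => \sum_(0 <= k < n) u k).
Proof.
move=> ux; apply: (@normed_cvg _ R^o u).
apply: (@series_le_cvg _ _ (fun k => rnorm (x k))) => //.
- by move=> k; exact: normr_ge0.
- by move=> k; exact: rnorm_ge0.
apply: nondecreasing_is_cvgn.
  by apply: nondecreasing_series => k _ _; exact: rnorm_ge0.
by exists (rnorm x) => _ [n _ <-]; exact: l1_partial_le.
Qed.

Definition l1_psum b x n : R[i]^o := \sum_(0 <= k < n) (b k)%:C%C * x k.

Definition l1_sum b x : R[i]^o := limn (l1_psum b x).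

Lemma Re_realM (r : R) (z : R[i]) : complex.Re (r%:C%C * z) = r * complex.Re z.
Proof. by case: z => u v /=; ring. Qed.

Lemma Im_realM (r : R) (z : R[i]) : complex.Im (r%:C%C * z) = r * complex.Im z.
Proof. by case: z => u v /=; ring. Qed.

Lemma l1_psum_cvg b x : (forall k, `|b k| <= 1) ->
  l1_psum b x n @[n --> \oo] --> l1_sum b x.
Proof.
move=> b1; have bp (p : R[i] -> R) k : `|p (x k)| <= rnorm (x k) ->
    `|b k * p (x k)| <= rnorm (x k).
  by move=> px; rewrite normrM -[leRHS]mul1r ler_pM.
have cRe := @l1_dominated_cvg x _ (fun k => bp (@complex.Re R) k (Re_le_rnorm _)).
have cIm := @l1_dominated_cvg x _ (fun k => bp (@complex.Im R) k (Im_le_rnorm _)).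
suff : cvgn (l1_psum b x) by [].
apply/cvg_ex; eexists.
rewrite (_ : l1_psum b x = fun n => Complex
    (\sum_(0 <= k < n) b k * complex.Re (x k))
    (\sum_(0 <= k < n) b k * complex.Im (x k))); last first.
  apply/funext => n; apply/eqP; rewrite eq_complex /= !raddf_sum /=.
  apply/andP; split; apply/eqP; apply: eq_bigr => k _; first exact: Re_realM.
  exact: Im_realM.
exact: cvg_ReIm cRe cIm.
Qed.

Lemma l1_sum_linear b (k : R[i]) x y : (forall k, `|b k| <= 1) ->
  l1_sum b (k *: x + y) = k * l1_sum b x + l1_sum b y.
Proof.
move=> b1; apply: cvg_lim => //.
rewrite (_ : l1_psum b (k *: x + y) = fun n => k * l1_psum b x n + l1_psum b y n).
  exact: (cvgD (cvgZl_tmp (l1_psum_cvg b1)) (l1_psum_cvg b1)).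
apply/funext => n; rewrite /l1_psum mulr_sumr -big_split/=.
apply: eq_bigr => j _; rewrite [RHS]addrC.
by rewrite mulrCA -mulrDr addrC.
Qed.

(** The bound does not depend on [b]; for [b = phi ^~ s] this is uniform convergence in [s]. *)
Lemma l1_sum_tail b x n : (forall k, `|b k| <= 1) ->
  rnorm (l1_sum b x - l1_psum b x n) <= rnorm x - \sum_(0 <= k < n) rnorm (x k).
Proof.
move=> b1.
have : (l1_psum b x m - l1_psum b x n) @[m --> \oo] --> l1_sum b x - l1_psum b x n.
  by apply: cvgB; [exact: l1_psum_cvg|exact: cvg_cst].
move/rnorm_lim_le; apply; exists n => // m /= nm.
rewrite /l1_psum (big_cat_nat (leq0n n) nm) /= addrAC subrr add0r.
rewrite lerBrDl (le_trans _ (l1_partial_le x m))//.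
rewrite [leRHS](big_cat_nat (leq0n n) nm) /= lerD2l.
rewrite (le_trans (rnorm_sum _ _ _))// ler_sum// => k _.
by rewrite rnormM rnormR -[leRHS]mul1r ler_wpM2r ?rnorm_ge0.
Qed.

End L1Series.

Section L1Embedding.
Variables (R : realType) (E : normedModType R[i]) (J : {linear E -> CDelta R}).
Variable phi : nat -> unit_itv R -> R.
Hypothesis phi_continuous : forall n, continuous (phi n).
Hypothesis phi_le1 : forall n s, `|phi n s| <= 1.
Hypothesis phi_cantor : forall n t, phi n (cantor_incl t) = 0.

Lemma l1_sum_continuous (x : l1 R) : continuous (fun s => l1_sum (phi ^~ s) x).
Proof.
move=> s; apply/(@cvg_rnormP _ _ _ (nbhs s)) => e e0.
have e3 : 0 < e / 3 by rewrite divr_gt0.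
have [n xn] := l1_tail_lt x e3.
have tail r : rnorm (l1_sum (phi ^~ r) x - l1_psum (phi ^~ r) x n) < e / 3.
  by apply: le_lt_trans xn; exact: l1_sum_tail.
have : l1_psum (phi ^~ r) x n @[r --> s] --> l1_psum (phi ^~ s) x n.
  apply: (@cvg_big _ _ _ _ _ _ _ (nbhs s)) => [|k _]; first exact: add_continuous.
  apply: (@cvgM _ _ (nbhs s)); last exact: cst_continuous.
  by apply: (@cvg_ReIm _ _ (nbhs s)); [exact: phi_continuous|exact: cst_continuous].
move/(@cvg_rnormP _ _ _ (nbhs s)) => /(_ _ e3); apply: filterS => r sr.
have -> : l1_sum (phi ^~ s) x - l1_sum (phi ^~ r) x =
  (l1_sum (phi ^~ s) x - l1_psum (phi ^~ s) x n) +
  (l1_psum (phi ^~ s) x n - l1_psum (phi ^~ r) x n) -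
  (l1_sum (phi ^~ r) x - l1_psum (phi ^~ r) x n).
  by ring.
apply: le_lt_trans (rnormD _ _) _; rewrite rnormN.
have := rnormD (l1_sum (phi ^~ s) x - l1_psum (phi ^~ s) x n)
  (l1_psum (phi ^~ s) x n - l1_psum (phi ^~ r) x n).
have := tail s; have := tail r; move: sr.
lra.
Qed.

(** [F x] is the series of the [x k] times [phi k], with trace 0. The tail estimate yields both the
    bound on [F], at [n = 0], and the lower estimate that follows. *)
Lemma l1_embedding_ex : exists F : bdop (l1 R) (XE J),
  forall x s n, rnorm (F x s - l1_psum (phi ^~ s) x n) <=
    rnorm x - \sum_(0 <= k < n) rnorm (x k).
Proof.
have Fex (x : l1 R) : {f : XE J | forall s, f s = l1_sum (phi ^~ s) x}.
  apply: (@XE_ex _ _ _ _ 0); first exact: l1_sum_continuous.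
  move=> t; rewrite linear0; apply: cvg_lim => //.
  rewrite (_ : l1_psum _ _ = fun=> 0); first exact: cvg_cst.
  by apply/funext => n; rewrite /l1_psum big1// => k _; rewrite phi_cantor mul0r.
pose F x : XE J := projT1 (Fex x).
have FE x s : F x s = l1_sum (phi ^~ s) x by rewrite /F; case: (Fex x).
have Ftail x s n : rnorm (F x s - l1_psum (phi ^~ s) x n) <=
    rnorm x - \sum_(0 <= k < n) rnorm (x k).
  by rewrite FE; exact: l1_sum_tail.
have FB : F \in @bdop_pred R (l1 R) (XE J).
  apply: bounded_linear_bdop.
    by move=> k x y; apply: XE_eq => s; rewrite XED XEZ !FE l1_sum_linear.
  exists 1 => x; rewrite mul1r; apply: XE_norm_le => [|s]; first exact: rnorm_ge0.
  by have := Ftail x s 0%N; rewrite /l1_psum !big_geq// !subr0.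
by exists (Bdop FB).
Qed.

(** At a point where the [phi n] have the signs of the real parts of the [x n], the series is at
    least [c] times the sum of their moduli, up to a tail. The same holds for the imaginary parts,
    and adding the two gives the factor 2. The upper bound [M] is asked on [I] only, where a
    hermitian operator will provide it. *)
Lemma l1_embedding_below (I : set (unit_itv R)) (c M : R) (F : l1 R -> XE J) x :
  0 < c ->
  (forall N (e : nat -> bool), exists2 s, I s &
    forall n, (n < N)%N -> c <= (-1) ^+ e n * phi n s) ->
  (forall x s n, rnorm (F x s - l1_psum (phi ^~ s) x n) <=
    rnorm x - \sum_(0 <= k < n) rnorm (x k)) ->
  (forall s, I s -> rnorm (F x s) <= M) -> c * rnorm x <= 2 * M.
Proof.
move=> c0 signs Ftail FM; apply/ler_addgt0Pr => d d0.
have c2 : 0 < c + 2 by rewrite ltr_wpDl ?ltW.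
(* The tail [t] enters once with factor [c] and once in each of the two halves, in all
   [(c + 2) * t < d]. *)
have [N] := l1_tail_lt x (divr_gt0 d0 c2); set t := _ - _ => td.
have half (p : {additive R[i] -> R}) :
    (forall r z, p (r%:C%C * z) = r * p z) ->
    (forall z : R[i]^o, `|p z| <= rnorm z) ->
    c * \sum_(0 <= k < N) `|p (x k)| <= M + t.
  move=> pM pn; have [s Is sN] := signs N (fun k => p (x k) < 0).
  have : c * \sum_(0 <= k < N) `|p (x k)| <= p (l1_psum (phi ^~ s) x N).
    rewrite /l1_psum raddf_sum mulr_sumr !big_mkord ler_sum// => k _ /=.
    rewrite pM; set q := p (x k).
    have -> : phi k s * q = ((-1) ^+ (q < 0)%R * phi k s) * `|q|.
      by rewrite [in RHS](normrEsign q) mulrACA -signr_addb addbb mul1r.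
    by rewrite ler_wpM2r// sN// ltn_ord.
  move/le_trans; apply.
  have -> : l1_psum (phi ^~ s) x N = F x s - (F x s - l1_psum (phi ^~ s) x N).
    by rewrite subKr.
  apply: le_trans (ler_norm _) _; apply: le_trans (pn _) _.
  by rewrite (le_trans (rnormD _ _))// rnormN lerD// FM.
have hRe := half (@complex.Re R) (@Re_realM R) (@Re_le_rnorm R).
have hIm := half (@complex.Im R) (@Im_realM R) (@Im_le_rnorm R).
have : \sum_(0 <= k < N) rnorm (x k) <= \sum_(0 <= k < N) `|complex.Re (x k)| +
    \sum_(0 <= k < N) `|complex.Im (x k)|.
  by rewrite -big_split/= ler_sum// => k _; exact: rnorm_le_ReIm.
move=> /(ler_wpM2l (ltW c0)); rewrite mulrDr => h.
have -> : rnorm x = t + \sum_(0 <= k < N) rnorm (x k) by rewrite /t subrK.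
move: td; rewrite ltr_pdivlMr// => td; move: h hRe hIm td; clear; nra.
Qed.

End L1Embedding.

(** * Hermitian operators on XE *)

Section Tent.
Variables (R : realType) (t d : R).
Hypothesis d0 : 0 < d.

Definition tent : R -> R := (fun=> 0 : R) \max (fun s => 1 - `|s - t| / d).

Lemma tent_continuous : continuous tent.
Proof.
move=> s; apply: continuous_max; first exact: cst_continuous.
apply: (@cvgB _ _ _ (nbhs s)); first exact: cst_continuous.
apply: (@cvgM _ _ (nbhs s)); last exact: cst_continuous.
apply: (@cvg_norm _ _ _ (nbhs s)).
by apply: (@cvgB _ _ _ (nbhs s)); [exact: cvg_id|exact: cst_continuous].
Qed.

Lemma tent_ge0 s : 0 <= tent s.
Proof. by rewrite /tent /= le_max lexx. Qed.

Lemma tent_le1 s : tent s <= 1.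
Proof. by rewrite /tent /= ge_max ler01 gerBl divr_ge0// ltW. Qed.

Lemma tent_center : tent t = 1.
Proof. by rewrite /tent /= subrr normr0 mul0r subr0 max_r. Qed.

Lemma tent_eq0 s : d < `|s - t| -> tent s = 0.
Proof.
by move=> ds; rewrite /tent /= max_l// subr_le0 ler_pdivlMr// mul1r ltW.
Qed.

Lemma tent_ge_half s : `|s - t| <= d / 2 -> 1 / 2 <= tent s.
Proof.
move=> ds; rewrite /tent /= le_max; apply/orP; right.
have : `|s - t| / d <= 1 / 2 by rewrite ler_pdivrMr// mulrC mulrA mulr1.
lra.
Qed.

End Tent.

(* Base-8 digits 0 and 4 put 8 ^ n x close to an integer or a half-integer, so
   the signs of the first N functions can be prescribed independently. *)
Lemma lacunary_cos_signs (R : realType) :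
  exists2 c : R, 0 < c &
  forall N (e : nat -> bool), exists2 x : R, 0 <= x <= 1 &
    forall n, (n < N)%N -> c <= (-1) ^+ e n * cos (pi *+ 2 * (8 ^+ n * x)).
Proof.
have p0 := pi_gt0 R.
exists (cos (pi / 7)).
  by apply: cos_gt0_pihalf; apply/andP; split; lra.
(* With digits 0 and 4 only, [x] stays below 0.444... in base 8, that is [4 / 7], a bound reproduced
   by [(4 + 4 / 7) / 8 = 4 / 7]. The digits after the first then shift the phase by at most
   [pi / 7], whence the constant. *)
move=> N e; suff [x /andP[x0 x1] xP] : exists2 x : R, 0 <= x <= 4 / 7 &
    forall n, (n < N)%N -> cos (pi / 7) <= (-1) ^+ e n * cos (pi *+ 2 * (8 ^+ n * x)).
  by exists x => //; apply/andP; split; lra.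
elim: N e => [|N IHN] e; first by exists 0 => //; apply/andP; split; lra.
have [y /andP[y0 y1] yP] := IHN (fun n => e n.+1).
(* A leading digit 4 adds [pi] to the phase at [n = 0] and flips the sign; for later [n] it
   contributes whole periods. *)
pose m := if e 0%N then 4%N else 0%N.
exists ((m%:R + y) / 8).
  by rewrite /m; case: (e 0%N); apply/andP; split; lra.
case=> [_|n nN].
  have cy : cos (pi / 7) <= cos (pi *+ 2 * (y / 8)).
    have a0 : 0 <= pi *+ 2 * (y / 8) :> R by apply: mulr_ge0; [rewrite mulrn_wge0 ?pi_ge0|lra].
    have a1 : pi *+ 2 * (y / 8) <= pi / 7 :> R by nra.
    have ap : pi / 7 <= pi :> R by lra.
    have [->//|ne] := eqVneq (pi / 7) (pi *+ 2 * (y / 8)).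
    apply: ltW; rewrite ltr_cos ?in_itv/=.
    - by rewrite lt_neqAle a1 andbT eq_sym.
    - by apply/andP; split; lra.
    - by apply/andP; split; lra.
  rewrite expr0 mul1r /m; case: (e 0%N); rewrite ?expr1 ?expr0 ?mulN1r ?mul1r.
    have -> : pi *+ 2 * ((4 + y) / 8) = pi *+ 2 * (y / 8) + pi :> R by field.
    by rewrite cosDpi opprK.
  by rewrite add0r.
have -> : pi *+ 2 * (8 ^+ n.+1 * ((m%:R + y) / 8)) =
    pi *+ 2 * (8 ^+ n * y) + (pi *+ 2) *+ (8 ^ n * m) :> R.
  by rewrite -[_ *+ (_ * _)]mulr_natr natrM natrX exprSr; field.
by rewrite (periodicn (@cosD2pi R)); apply: yP.
Qed.

(** * Locality off the Cantor set *)

Section HermitianLocality.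
Variables (R : realType) (E : normedModType R[i]) (J : {linear E -> CDelta R}).
Local Notation X := (XE J).
Implicit Types (f g : X) (T : bdop X X) (s : unit_itv R).

Lemma point_eval_subproof s : (fun f => f s) \in @bdop_pred R X R[i]^o.
Proof.
apply: bounded_linear_bdop; first by move=> k f g; rewrite XED XEZ.
by exists 1 => f; rewrite mul1r XE_le.
Qed.

Definition point_eval s : dual_space X := Bdop (point_eval_subproof s).

Lemma off_cantor_ball s : ~ cantor_set R (val s) ->
  exists2 d : R, 0 < d & forall r, `|r - val s| <= d -> ~ cantor_set R r.
Proof.
move=> nDs; have : nbhs (val s) (~` cantor_set R).
  by apply: open_nbhs_nbhs; split => //; apply: closed_openC; exact: cantor_set_closed.
move=> /nbhs_ballP[e /= e0 eD]; exists (e / 2); first by rewrite divr_gt0.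
move=> r rs; apply: eD; rewrite /ball/= distrC (le_lt_trans rs)//.
by rewrite gtr_pMr// invf_lt1// ltr1n.
Qed.

(** Evaluation at [s] is a functional of norm 1 attaining its norm at [f], so [T f s] lies in the
    numerical range. *)
Lemma hermitian_real T f s : hermitian_op T -> rnorm f = 1 -> f s = 1 ->
  (T f) s \is Num.real.
Proof.
move=> hT f1 fs; apply: hT; exists f, (point_eval s); split => //.
  by rewrite rnormE f1.
rewrite rnormE; congr (_ %:C)%C; apply/eqP; rewrite eq_le; apply/andP; split.
  by apply: bdop_norm_le => // g; rewrite mul1r XE_le.
have := bdop_le (point_eval s) f; rewrite f1 mulr1 [point_eval s f]fs.
by rewrite -{1}[1]/(1%:C)%C rnormR normr1.
Qed.

(* If f vanishes at s and |f| <= 1, then tent * (1 - |f|) + w f has norm 1 and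
   value 1 at s for every unimodular w. *)
Lemma hermitian_local_le1 T f s : hermitian_op T -> ~ cantor_set R (val s) ->
  rnorm f <= 1 -> f s = 0 -> (T f) s = 0.
Proof.
move=> hT nDs f1 fs0; have [d d0 dD] := off_cantor_ball nDs.
(* The factor [1 - rnorm (f r)] leaves room for [w *: f] in the unit ball; the tent makes [g] vanish
   on the Cantor set, so that it lifts to [X] with trace 0. *)
pose g (r : unit_itv R) : R := tent (val s) d (val r) * (1 - rnorm (f r)).
have gD t : g (cantor_incl t) = 0.
  rewrite /g tent_eq0 ?mul0r// ltNge; apply/negP => /dD; apply.
  exact: (set_valP t).
have cg : continuous g.
  move=> r; apply: (@cvgM _ _ (nbhs r)).
    apply: continuous_comp; last exact: tent_continuous.
    exact: (@initial_continuous (unit_itv R) R set_val).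
  apply: (@cvgB _ _ _ (nbhs r)); first exact: cst_continuous.
  by apply: (@cvg_rnorm _ _ _ (nbhs r)); exact: XE_continuous.
have [||G GE] := @XE_ex _ _ J (fun r => (g r)%:C%C) 0.
- by move=> r; apply: (@cvg_ReIm _ _ (nbhs r)); [exact: cg|exact: cst_continuous].
- by move=> t; rewrite gD linear0.
have zs (w : R[i]) : (G + w *: f) s = 1.
  by rewrite XED XEZ fs0 mulr0 addr0 GE /g tent_center fs0 rnorm0 subr0 mulr1.
have z1 (w : R[i]) : rnorm (w : R[i]^o) = 1 -> rnorm (G + w *: f) = 1.
  move=> w1; apply/eqP; rewrite eq_le; apply/andP; split; last first.
    by have := XE_le (G + w *: f) s; rewrite zs -{1}[1]/(1%:C)%C rnormR normr1.
  apply: XE_norm_le => // r; rewrite XED XEZ GE (le_trans (rnormD _ _))//.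
  rewrite rnormM w1 mul1r rnormR -lerBrDr.
  have fr : 0 <= 1 - rnorm (f r) by rewrite subr_ge0 (le_trans (XE_le f r)).
  rewrite /g ger0_norm ?mulr_ge0 ?tent_ge0// -[leRHS]mul1r.
  by rewrite ler_wpM2r// tent_le1.
have Tw (w : R[i]) : rnorm (w : R[i]^o) = 1 ->
    complex.Im ((T G) s + w * (T f) s) = 0.
  move=> w1; have := hermitian_real hT (z1 w w1) (zs w).
  by rewrite bdopD bdopZ XED XEZ => /real_Im0.
have n1 (a b : R) : a ^+ 2 + b ^+ 2 = 1 -> rnorm (Complex a b : R[i]^o) = 1.
  move=> ab; apply/eqP; rewrite -(@eqrXn2 _ 2)// ?rnorm_ge0// rnorm_sqr /=.
  by rewrite ab expr1n.
(* Comparing [w = 1] with [-1] kills the imaginary part of [T f s], and [i] with [-i] its real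
   part. *)
have := Tw (Complex 1 0); have := Tw (Complex (-1) 0).
have := Tw (Complex 0 1); have := Tw (Complex 0 (-1)).
rewrite !n1 ?expr0n ?expr1n ?sqrrN ?expr1n ?addr0 ?add0r//.
case: ((T G) s) => p q; case: ((T f) s) => u v /=.
move=> /(_ erefl) h1 /(_ erefl) h2 /(_ erefl) h3 /(_ erefl) h4.
by apply/eqP; rewrite eq_complex /=; apply/andP; split; apply/eqP; lra.
Qed.

Lemma hermitian_local T f s : hermitian_op T -> ~ cantor_set R (val s) ->
  f s = 0 -> (T f) s = 0.
Proof.
move=> hT nDs fs0; pose k : R := (1 + rnorm f)^-1.
have k0 : 0 < 1 + rnorm f by rewrite ltr_pwDl ?rnorm_ge0.
have kf1 : rnorm (k%:C%C *: f) <= 1.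
  rewrite rnormZ rnormR ger0_norm; last by rewrite invr_ge0 ltW.
  by rewrite /k mulrC ler_pdivrMr// mul1r lerDr.
have kf0 : (k%:C%C *: f) s = 0.
  by apply: etrans (XEZ _ _ _) _; rewrite fs0; exact: mulr0.
have := hermitian_local_le1 hT nDs kf1 kf0.
have -> : T (k%:C%C *: f) s = k%:C%C * T f s by rewrite bdopZ.
move/eqP; rewrite mulf_eq0 => /orP[|/eqP//].
by rewrite eq_complex /= invr_eq0 gt_eqF.
Qed.

(** Locality applied to [f s *: g - g s *: f], which vanishes at [s]: off the Cantor set [T] acts as
    a multiplication operator. *)
Lemma hermitian_multiplier T f g s : hermitian_op T -> ~ cantor_set R (val s) ->
  f s * (T g) s = g s * (T f) s.
Proof.
move=> hT nDs; pose a : R[i] := f s; pose b : R[i] := g s.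
have h0 : (a *: g - b *: f) s = 0.
  have -> : (a *: g - b *: f) s = a * b - b * a by [].
  by rewrite mulrC subrr.
have := hermitian_local hT nDs h0.
have -> : T (a *: g - b *: f) = a *: T g - b *: T f.
  by rewrite bdopB !bdopZ.
have -> : (a *: T g - b *: T f) s = a * (T g) s - b * (T f) s by [].
by move/eqP; rewrite subr_eq0 => /eqP.
Qed.

(** The complement of the Cantor set is dense in [0, 1], so a continuous function vanishing there is
    0. *)
Lemma XE_neq0_off_cantor f : f <> 0 ->
  exists s, ~ cantor_set R (val s) /\ f s <> 0.
Proof.
move=> f0; apply/not_existsP => fD; apply: f0; apply: XE_eq => s.
apply/rnorm_eq0/eqP; rewrite eq_le rnorm_ge0 andbT; apply/ler_addgt0Pr => e e0.
rewrite add0r.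
have /(@cvg_rnormP _ _ _ (nbhs s))/(_ e e0) := @XE_continuous _ _ _ f s.
move=> [_ [[B oB <-] Bs] sub].
have : nbhs (val s) B by apply: open_nbhs_nbhs.
move=> /nbhs_ballP[d /= d0 dB].
have [n nd] : exists n, 3 ^- n < d.
  exists (Num.bound d^-1); rewrite invf_plt ?posrE ?exprn_gt0//.
  have dV : 0 <= d^-1 by rewrite invr_ge0 ltW.
  apply: lt_le_trans (archi_boundP dV) _.
  by rewrite -natrX ler_nat ltnW// ltn_expl.
have s01 : 0 <= val s <= 1 by have := set_valP s; rewrite /unit_itv/= in_itv.
have [y [y01 ys nDy]] := cantor_set_empty_interior n s01.
have yI : y \in unit_itv R by rewrite inE /unit_itv/= in_itv.
have /sub : B (val (exist _ y yI : unit_itv R)).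
  by apply: dB; rewrite /ball/= distrC (le_lt_trans ys).
have fy0 : f (exist _ y yI) = 0.
  by have := fD (exist _ y yI) => /not_andP[//|/contrapT].
by rewrite /= fy0 subr0 => /ltW.
Qed.

End HermitianLocality.

(** * A copy of l1 fixed by a hermitian operator *)

Section HermitianFixesL1.
Variables (R : realType) (E : normedModType R[i]) (J : {linear E -> CDelta R}).
Local Notation X := (XE J).

Lemma hermitian_fixes_l1 (T : bdop X X) :
  T <> 0 -> hermitian_op T -> fixes_copy_of_l1 T.
Proof.
move=> T0 hT.
have [f Tf0] : exists f, T f <> 0.
  apply/not_existsP => Tf; apply: T0; apply/val_inj/funext => f /=.
  exact: contrapT (Tf f).
have [s [nDs Tfs]] := XE_neq0_off_cantor Tf0.
pose k := rnorm (T f s) / 2.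
have k0 : 0 < k.
  by rewrite divr_gt0// lt0r rnorm_ge0 andbT; apply/eqP => /rnorm_eq0.
have [d1 d10 d1D] := off_cantor_ball nDs.
have [e e0 eT] : exists2 e : R, 0 < e &
    forall r : unit_itv R, `|val r - val s| < e -> k <= rnorm (T f r).
  have /(@cvg_rnormP _ _ _ (nbhs s))/(_ k k0) := @XE_continuous _ _ _ (T f) s.
  move=> [_ [[B oB <-] Bs] sub].
  have : nbhs (val s) B by apply: open_nbhs_nbhs.
  move=> /nbhs_ballP[e /= e0 eB]; exists e => // r rs.
  have /sub : B (val r) by apply: eB; rewrite /ball/= distrC.
  have := rnormD (T f s - T f r) (T f r); rewrite subrK /= /k.
  lra.
pose d := Num.min d1 (e / 2).
have d0 : 0 < d by rewrite lt_min d10 divr_gt0.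
have dD r : `|r - val s| <= d -> ~ cantor_set R r.
  by move=> rs; apply: d1D; rewrite (le_trans rs)// ge_min lexx.
have dT (r : unit_itv R) : `|val r - val s| <= d -> k <= rnorm (T f r).
  move=> rs; apply: eT; rewrite (le_lt_trans rs)// gt_min; apply/orP; right.
  by rewrite gtr_pMr// invf_lt1// ltr1n.
have /andP[s0 s1] : 0 <= val s <= 1.
  by have := set_valP s; rewrite /unit_itv/= in_itv.
(* The endpoint 1 belongs to the Cantor set, so the interval to the right of [s] avoiding that set
   ends before 1 and stays inside [0, 1]. *)
have sd1 : val s + d <= 1.
  rewrite leNgt; apply/negP => sd; apply: (dD 1); last exact: cantor_set1.
  by rewrite ger0_norm ?subr_ge0// lerBlDl ltW.
have [c c0 signs] := lacunary_cos_signs R.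
(* The argument of the cosine carries [[s, s + d / 2]] onto [0, 1]; there the tent is at least
   [1 / 2], which gives the constant [c / 2] in [signsI]. *)
pose u n (x : R) := tent (val s) d x * cos (pi *+ 2 * (8 ^+ n * (2 * (x - val s) / d))).
pose phi n (r : unit_itv R) := u n (val r).
have cu n : continuous (u n).
  move=> x; apply: (@cvgM _ _ (nbhs x)); first exact: tent_continuous.
  apply: continuous_comp; last exact: continuous_cos.
  apply: (@cvgM _ _ (nbhs x)); first exact: cst_continuous.
  apply: (@cvgM _ _ (nbhs x)); first exact: cst_continuous.
  apply: (@cvgM _ _ (nbhs x)); last exact: cst_continuous.
  apply: (@cvgM _ _ (nbhs x)); first exact: cst_continuous.
  by apply: (@cvgB _ _ _ (nbhs x)); [exact: cvg_id|exact: cst_continuous].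
have cphi n : continuous (phi n).
  move=> r; have cval := @initial_continuous (unit_itv R) R set_val.
  exact: continuous_comp (cval r) (cu n _).
have phi1 n r : `|phi n r| <= 1.
  rewrite /phi /u normrM -[leRHS]mul1r ler_pM ?cos_max//.
  by rewrite ger0_norm ?tent_ge0 ?tent_le1.
have phiD n t : phi n (cantor_incl t) = 0.
  rewrite /phi /u tent_eq0 ?mul0r// ltNge; apply/negP => /dD; apply.
  exact: (set_valP t).
have [F Ftail] := l1_embedding_ex J cphi phi1 phiD.
pose I : set (unit_itv R) := [set r | `|val r - val s| <= d].
have c2 : 0 < c / 2 by rewrite divr_gt0.
have signsI N (w : nat -> bool) : exists2 r, I r &
    forall n, (n < N)%N -> c / 2 <= (-1) ^+ w n * phi n r.
  have [x /andP[x0 x1] xP] := signs N w.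
  have dx : d / 2 * x <= d / 2 by rewrite ler_piMr// ltW// divr_gt0.
  have dx0 : 0 <= d / 2 * x by rewrite mulr_ge0// ltW// divr_gt0.
  have rI : val s + d / 2 * x \in unit_itv R.
    rewrite inE /unit_itv/= in_itv/= addr_ge0//= (le_trans _ sd1)// lerD2l.
    by lra.
  pose r0 : unit_itv R := exist _ (val s + d / 2 * x) rI; exists r0.
    by rewrite /I/= addrAC subrr add0r ger0_norm// (le_trans dx)//; lra.
  move=> n nN; rewrite /phi /u /=.
  have -> : 2 * (val s + d / 2 * x - val s) / d = x.
    by field; rewrite gt_eqF.
  have p2 : 1 / 2 <= tent (val s) d (val s + d / 2 * x).
    by apply: tent_ge_half => //; rewrite addrAC subrr add0r ger0_norm.
  rewrite mulrCA mulrC -[X in X * c <= _]div1r.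
  by rewrite ler_pM ?xP// ltW.
have below x M := @l1_embedding_below R E J phi I (c / 2) M F x c2 signsI Ftail.
(* On [I] the multiplier identity gives [|F x| |T f| = |f| |T (F x)|] with [|T f| >= k], so a small
   [T (F x)] forces [F x] to be small on [I], which [below] turns into a bound on [x]. *)
have TF x : c * k * rnorm x <= 4 * rnorm f * rnorm (T (F x)).
  have bound r : I r -> rnorm (F x r) <= rnorm f * rnorm (T (F x)) / k.
    move=> Ir; rewrite ler_pdivlMr//.
    have Tfr := dT r Ir; have nDr := dD _ Ir.
    apply: le_trans (_ : rnorm (F x r) * rnorm (T f r) <= _).
      by rewrite ler_wpM2l ?rnorm_ge0.
    rewrite -rnormM (@hermitian_multiplier _ _ _ T (F x) f r hT nDr) rnormM.
    by rewrite ler_pM ?rnorm_ge0 ?XE_le.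
  have := below x _ bound; rewrite mulrA ler_pdivlMr//.
  by move: (rnorm f) (rnorm (T _)) (rnorm x) => *; lra.
have f1 : 0 < rnorm f + 1 by rewrite ltr_wpDl ?rnorm_ge0.
have F1 : 0 < rnorm F + 1 by rewrite ltr_wpDl ?rnorm_ge0.
have q0 : 0 < 4 * (rnorm f + 1) * (rnorm F + 1).
  by rewrite mulr_gt0// mulr_gt0// ltr0n.
(* The constant [c / 4] is [below] with [M = rnorm (F x)]; the other combines [TF] with
   [rnorm (F x) <= rnorm F * rnorm x], the added ones keeping the denominator positive. *)
apply: (@fixes_l1_of_bounded_below _ _ T F (c / 4)
  (c * k / (4 * (rnorm f + 1) * (rnorm F + 1)))).
- by rewrite divr_gt0.
- exact: divr_gt0 (mulr_gt0 c0 k0) q0.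
- move=> x; have := below x (rnorm (F x)) (fun r _ => XE_le _ _); lra.
- move=> x; rewrite mulrAC ler_pdivrMr//.
  have h1 := ler_wpM2l (ltW (mulr_gt0 c0 k0)) (bdop_le F x).
  have h2 := ler_wpM2l (rnorm_ge0 F) (TF x).
  have t0 := rnorm_ge0 (T (F x)).
  have h3 := mulr_ge0 t0 (rnorm_ge0 f); have h4 := mulr_ge0 t0 (rnorm_ge0 F).
  move: (rnorm f) (rnorm F) (rnorm x) (rnorm (F x)) (rnorm (T (F x))) h1 h2 t0 h3 h4.
  by clear => *; lra.
Qed.

End HermitianFixesL1.

Theorem mainTheorem5 (R : realType) (J : {linear l2 R -> CDelta R})
    (J_isometry : forall x : l2 R, `|J x| = `|x|) :
  (forall T : bdop (XE J) (XE J),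
      T <> 0 -> hermitian_op T -> fixes_copy_of_l1 T) /\
  (exists S : set (bdop (dual_space (XE J)) (dual_space (XE J))),
      [/\ subspace_over (real_scalars R) S,
          ~ finite_dim_over (real_scalars R) S &
          forall T, S T -> finite_rank T /\ hermitian_op T]).
Proof.
split; first exact: hermitian_fixes_l1.
exists (diag_span J_isometry); split.
- exact: diag_span_subspace.
- exact: diag_span_infinite_dim.
- by move=> T ST; split; [exact: diag_span_finite_rank ST|exact: diag_span_hermitian ST].
Qed.
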